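(* Let $G(n,d)$, $d=d(n)$, be a random $d$-regular graph on $n$ vertices with $d=\Theta(n)$. Then there exists a positive constant $C_3'$ such that $$\max_{s\le\frac12\frac{\log n}{\log\gamma_{d/n}}-C_3'\log\log n}\ \max_{H_s\in\mathcal{G}(s)}\left|\frac{n_{G(n,d)}(H_s)}{\frac{(n)_s}{|\mathrm{Aut}(H_s)|}\left(\frac{d/n}{1-d/n}\right)^{|E(H_s)|}\left(1-\frac dn\right)^{\binom s2}}-1\right|\longrightarrow0$$ as $n\to\infty$, in probability.
   Context: $G(n,d)$ is chosen uniformly at random among all $d$-regular graphs on vertex set $[n]=\{1,\dots,n\}$. $a_n=\Theta(b_n)$ means there are positive constants $c_1,c_2$ with $c_1a_n\le b_n\le c_2a_n$ for all large $n$. $\mathcal{G}(s)$ is the set of all graphs with vertex set $[s]$ ($s$ a positive integer); for graphs $G,H$, $n_G(H)$ is the number of induced isomorphic copies of $H$ in $G$ (number of vertex subsets of $G$ inducing a subgraph isomorphic to $H$); $E(H)$ and $\mathrm{Aut}(H)$ are the edge set and automorphism group of $H$; $(n)_s=n(n-1)\cdots(n-s+1)$; $\gamma_p=\max\{p^{-1},(1-p)^{-1}\}$; $\log$ is the natural logarithm. *)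

(* Defs.v *)
From HB Require Import structures.
From mathcomp Require Import all_boot all_order all_algebra fingroup.perm.
From mathcomp Require Import all_classical all_reals all_analysis.
Set Implicit Arguments.
Unset Strict Implicit.
Unset Printing Implicit Defensive.
Import Order.TTheory GRing.Theory Num.Theory.
Import numFieldNormedType.Exports.
Local Open Scope classical_set_scope.
Local Open Scope ring_scope.

(* Finite simple graphs: sets of two-element subsets of the vertex type. *)
Record sgraph (V : finType) := SGraph {
  edges : {set {set V}};
  _ : [forall e in edges, #|e| == 2] }.

HB.instance Definition _ (V : finType) := [isSub for @edges V].
HB.instance Definition _ (V : finType) := [Countable of sgraph V by <:].
HB.instance Definition _ (V : finType) := [Finite of sgraph V by <:].

Definition adj (V : finType) (G : sgraph V) (x y : V) : bool :=
  [set x; y]%SET \in edges G.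

Definition degree (V : finType) (G : sgraph V) (x : V) : nat :=
  #|[set y | adj G x y]%SET|.

Definition regular_graphs (n d : nat) : {set sgraph 'I_n} :=
  [set G : sgraph 'I_n | [forall x, degree G x == d]]%SET.

Lemma induced_subproof (V : finType) (G : sgraph V) (S : {set V}) :
  [forall e in [set e : {set {x : V | x \in S}} |
                 [set val x | x in e]%SET \in edges G]%SET, #|e| == 2].
Proof.
apply/forall_inP => e; rewrite inE => eG.
rewrite -(card_imset _ val_inj).
by case: G eG => E /= /forall_inP; apply.
Qed.

Definition induced (V : finType) (G : sgraph V) (S : {set V}) :
    sgraph {x : V | x \in S} :=
  SGraph (induced_subproof G S).

Definition isomorphic (V W : finType) (G : sgraph V) (H : sgraph W) : bool :=
  [exists f : {ffun V -> W},
    [&& injectiveb f, [forall w, w \in codom f]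
      & [forall x, forall y, adj H (f x) (f y) == adj G x y]]].

Definition Aut_graph (V : finType) (G : sgraph V) : {set {perm V}} :=
  [set f : {perm V} | [forall x, forall y, adj G (f x) (f y) == adj G x y]]%SET.

Definition induced_copies (V W : finType) (G : sgraph V) (H : sgraph W) : nat :=
  #|[set S : {set V} | isomorphic (induced G S) H]%SET|.

Definition unif_pr (R : realType) (T : finType) (A : {set T}) (P : pred T) : R :=
  #|[set x in A | P x]%SET|%:R / #|A|%:R.

Definition gamma (R : realType) (p : R) : R := Num.max p^-1 (1 - p)^-1.

Definition expected_copies (R : realType) (n : nat) (p : R) (s : nat)
    (H : sgraph 'I_s) : R :=
  (n ^_ s)%:R / #|Aut_graph H|%:R
    * (p / (1 - p)) ^+ #|edges H| * (1 - p) ^+ 'C(s, 2).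

Definition copies_deviation (R : realType) (n : nat) (p : R) (G : sgraph 'I_n)
    (s : nat) (H : sgraph 'I_s) : R :=
  `|(induced_copies G H)%:R / expected_copies n p H - 1|.

(* The maximum over all positive integers s <= b and all graphs H on s vertices;
   since the deviations are nonnegative, 0 serves as the maximum over the empty
   range. [Num.truncn b] is the floor of b when 0 <= b, and 0 when b < 0. *)
Definition max_deviation (R : realType) (n : nat) (p b : R) (G : sgraph 'I_n) : R :=
  \big[Num.max/0]_(1 <= s < (Num.truncn b).+1)
    \big[Num.max/0]_(H : sgraph 'I_s) copies_deviation p G H.

Definition size_bound (R : realType) (C : R) (n : nat) (p : R) : R :=
  1 / 2 * (ln n%:R / ln (gamma p)) - C * ln (ln n%:R).

(* Main.v *)
Require Import Defs.
From mathcomp Require Import all_boot all_order all_algebra fingroup.perm.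
From mathcomp Require Import all_classical all_reals all_analysis.
From mathcomp Require Import ring lra zify.
Set Implicit Arguments.
Unset Strict Implicit.
Unset Printing Implicit Defensive.
Import Order.TTheory GRing.Theory Num.Theory.
Import numFieldNormedType.Exports.
Local Open Scope classical_set_scope.
Local Open Scope ring_scope.

(** Fix [n], [d] and [p = d / n], and write [L = ln n].

    A graph is _jumbled_ when the number of pairs of [A * B] that are adjacent
    differs from [p |A| |B|] by at most [b (|A| + |B|)], for all vertex sets
    [A] and [B].  The theorem splits into a probabilistic and a deterministic
    half that meet at [b = 5 sqrt n L].

    Random regular graphs are jumbled.  For fixed [A] and [B], an exponential
    moment argument shows that a uniformly random set of [m = n d / 2] edges has
    deviation more than [b (|A| + |B|)] with probability at most about
    [exp (- c n L ^ 2)] ([uniform_subset_tail]).  This is so small that very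
    rough losses are affordable: there are [4 ^ n] pairs [(A, B)], and being
    [d]-regular has probability at least [n ^ (- n)] among all graphs with [m]
    edges.  For the latter bound, there are at most [n ^ n] degree sequences, and the constant one is the most frequent: moving
    an edge from a vertex of larger degree to a vertex of smaller degree shows
    that the number of graphs does not decrease when a degree sequence gets
    more balanced ([with_degrees_switch_le], [count_regular_ge]).  The result
    is [unif_pr_not_jumbled].

    Jumbled graphs have the right counts.  Count maps from ['I_s] to the
    vertices that satisfy a set [F] of prescribed adjacencies and
    non-adjacencies.  Dropping one pair [(i, j)] from [F] should divide the
    count by the density of that pair.  If all other vertices are fixed, the
    candidates for [i] and for [j] form two sets [A] and [B], so the error
    is at most [b (|A| + |B|)], and the sum of these errors is a count of
    maps that satisfy fewer constraints ([sat_remove_pair]).  Induction on [F]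
    gives relative error [|F| eta] with [eta] of order [b gamma ^ s / n]
    ([sat_count_density]).  The range of [s] is exactly what makes
    [gamma ^ s <= sqrt n / L ^ 5], so that the relative error is [O(1 / L ^ 2)],
    for all [s] and all [H] at once ([jumbled_copies_deviation]).

    Finally, with all pairs prescribed, the maps counted are the embeddings of
    [H], which are [|Aut H|] times as many as its induced copies
    ([card_embeddings]). *)

(** * Graphs as edge sets *)

Definition pairs (V : finType) : {set {set V}} := [set e : {set V} | #|e| == 2%N]%SET.

Lemma edgesP (V : finType) (G : sgraph V) : edges G \subset pairs V.
Proof.
by case: G => E /= /forall_inP h; apply/fintype.subsetP => e /h; rewrite inE.
Qed.

Lemma graph_of_subproof (V : finType) (S : {set {set V}}) :
  [forall e in S :&: pairs V, #|e| == 2%N]%SET.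
Proof. by apply/forall_inP => e; rewrite !inE => /andP[]. Qed.

Definition graph_of (V : finType) (S : {set {set V}}) : sgraph V :=
  SGraph (graph_of_subproof S).

Lemma adjC (V : finType) (G : sgraph V) x y : adj G x y = adj G y x.
Proof. by rewrite /adj finset.setUC. Qed.

Lemma adjxx (V : finType) (G : sgraph V) x : adj G x x = false.
Proof.
apply/negP => /(fintype.subsetP (edgesP G)).
by rewrite inE finset.setUid cards1.
Qed.

Lemma pairsE (V : finType) (x y : V) : ([set x; y]%SET \in pairs V) = (x != y).
Proof. by rewrite inE cards2; case: (x != y). Qed.

Lemma eq_pair (V : finType) (x y i k : V) :
  ([set x; y] == [set i; k])%SET = (x == i) && (y == k) || (x == k) && (y == i).
Proof.
apply/eqP/idP => [E|]; last first.
  by case/orP => /andP[/eqP-> /eqP->] //; rewrite finset.setUC.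
have: x \in [set i; k]%SET by rewrite -E !inE eqxx.
have: y \in [set i; k]%SET by rewrite -E !inE eqxx orbT.
have: i \in [set x; y]%SET by rewrite E !inE eqxx.
have: k \in [set x; y]%SET by rewrite E !inE eqxx orbT.
rewrite !inE ![k == _]eq_sym ![i == _]eq_sym.
by case: (x == i); case: (x == k); case: (y == i); case: (y == k).
Qed.

Lemma edges_graph_of (V : finType) (S : {set {set V}}) : S \subset pairs V ->
  edges (graph_of S) = S.
Proof. by move=> h; apply/finset.setIidPl. Qed.

(** Transfers counting problems from graphs to sets of pairs, where the
    randomness is that of a random subset. *)
Lemma card_graphs (V : finType) (P : pred {set {set V}}) :
  #|[set G : sgraph V | P (edges G)]%SET| =
  #|[set S : {set {set V}} | (S \subset pairs V) && P S]%SET|.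
Proof.
rewrite -(card_imset _ (@val_inj _ _ (sgraph V))) /=; apply: eq_card => S.
apply/imsetP/idP => [[G]|]; rewrite inE.
  by move=> PG ->; rewrite inE PG edgesP.
case/andP=> sub PS; exists (graph_of S); last by rewrite /= (finset.setIidPl sub).
by rewrite inE edges_graph_of.
Qed.

Lemma handshake (V : finType) (G : sgraph V) :
  (\sum_x degree G x = 2 * #|edges G|)%N.
Proof.
transitivity (\sum_x \sum_(e in edges G) (x \in e : nat))%N.
  apply: eq_bigr => x _; rewrite -big_mkcondr sum1_card /degree.
  rewrite -(card_in_imset (f := fun y => [set x; y]%SET)); last first.
    by move=> y z _ _ /eqP; rewrite eq_pair => /orP[] /andP[/eqP e1 /eqP e2]; congruence.
  apply: eq_card => e; apply/imsetP/idP => [[y]|].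
    by rewrite !inE => xy ->; apply/andP; split; rewrite // !inE eqxx.
  case/andP=> eG xe.
  have := fintype.subsetP (edgesP G) _ eG; rewrite inE => /cards2P[a [b [ab E]]].
  subst e; move: xe; rewrite !inE => /orP[]/eqP ->.
    by exists b; rewrite ?inE.
  by exists a; rewrite ?inE 1?adjC // finset.setUC.
rewrite exchange_big /= mulnC -sum_nat_const; apply: eq_bigr => e eG.
have := fintype.subsetP (edgesP G) _ eG; rewrite inE => /eqP <-.
by rewrite -big_mkcond /= sum1_card.
Qed.

Lemma degree_lt (n : nat) (G : sgraph 'I_n) x : (degree G x < n)%N.
Proof.
rewrite -[X in (_ < X)%N]card_ord; apply/proper_card/properP; split.
  exact/fintype.subsetP.
by exists x => //; rewrite inE adjxx.
Qed.

(** * The regular degree sequence is the most frequent one *)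

Definition with_degrees (V : finType) (f : V -> nat) : {set sgraph V} :=
  [set G : sgraph V | [forall x, degree G x == f x]]%SET.

(** The symmetric difference with the two pairs [{i, k}] and [{j, k}]: when
    exactly one of them is an edge, it gets replaced by the other one.  This
    form makes the operation an involution. *)
Definition switch (V : finType) (i j k : V) (G : sgraph V) : sgraph V :=
  graph_of [set e | (e \in edges G)
                    (+) ((e == [set i; k]) || (e == [set j; k]))]%SET.

Lemma adj_switch (V : finType) (i j k : V) (G : sgraph V) x y :
  k != i -> k != j ->
  adj (switch i j k G) x y = adj G x y (+)
    (((x == i) || (x == j)) && (y == k) || (x == k) && ((y == i) || (y == j))).
Proof.
move=> ki kj; rewrite /adj /switch /= inE pairsE inE !eq_pair.
have [->|xy] /= := eqVneq x y; last first.
  rewrite andbT; congr (_ (+) _).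
  by case: (x == i); case: (x == j); case: (x == k);
     case: (y == i); case: (y == j); case: (y == k).
rewrite andbF -/(adj G y y) adjxx /=.
have [->|] := eqVneq y k; last by rewrite !andbF.
by rewrite (negbTE ki) (negbTE kj).
Qed.

Lemma switchK (V : finType) (i j k : V) : k != i -> k != j ->
  involutive (@switch V i j k).
Proof.
move=> ki kj G; apply: val_inj => /=; apply/setP => e.
have E := fintype.subsetP (edgesP G) e.
rewrite !inE; have [c2|c2] := boolP (#|e| == 2%N).
  by rewrite !andbT -addbA addbb addbF.
by rewrite andbF; apply/esym/negP => /E; rewrite inE (negbTE c2).
Qed.

(** The vertices [k] for which the edge [{i, k}] can be moved to [{j, k}]. *)
Definition private (V : finType) (G : sgraph V) (i j : V) : {set V} :=
  [set k | [&& adj G i k, ~~ adj G j k & k != j]]%SET.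

(** The common neighbours of [i] and [j], and the possible edge between them,
    contribute equally to both degrees. *)
Lemma private_degree (V : finType) (G : sgraph V) (i j : V) : i != j ->
  (#|private G i j| + degree G j = #|private G j i| + degree G i)%N.
Proof.
move=> ij.
have key a b : a != b -> (degree G a = #|[set k | adj G a k && adj G b k]%SET|
    + adj G a b + #|private G a b|)%N.
  move=> ab; rewrite /degree.
  rewrite -(cardsID [set k | adj G b k]%SET).
  rewrite -addnA; congr (_ + _)%N; first by apply: eq_card => k; rewrite !inE.
  rewrite (cardsD1 b) !inE adjxx /=; congr (_ + _)%N.
  by apply: eq_card => k; rewrite !inE; case: (k == b); case: adj; case: adj.
rewrite (key _ _ ij) (key j i) 1?eq_sym // [adj G j i]adjC.
rewrite (_ : [set k | adj G j k && adj G i k]%SET = [set k | adj G i k && adj G j k]%SET).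
  by lia.
by apply/setP => k; rewrite !inE andbC.
Qed.

Lemma switch_degree (V : finType) (G : sgraph V) (i j k : V) : i != j ->
  k \in private G i j ->
  [/\ (degree (switch i j k G) i).+1 = degree G i,
      degree (switch i j k G) j = (degree G j).+1,
      (forall x, x != i -> x != j -> degree (switch i j k G) x = degree G x),
      k \in private (switch i j k G) j i
    & #|private (switch i j k G) j i| = #|private G j i|.+1].
Proof.
move=> ij; rewrite inE => /and3P[ik jk kj].
have ki : k != i by apply: contraTneq ik => ->; rewrite adjxx.
have A := adj_switch G _ _ ki kj.
have ji : (j == i) = false by rewrite eq_sym (negbTE ij).
split.
- rewrite /degree [RHS](cardsD1 k) inE ik add1n; congr _.+1.
  apply: eq_card => y; rewrite !inE A eqxx /=.
  rewrite [i == k]eq_sym ?(negbTE ki) /= orbF.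
  by have [->|] /= := eqVneq y k; rewrite ?addbF // ik.
- rewrite /degree [LHS](cardsD1 k) inE A !eqxx ?orbT ?(negbTE jk) /= add1n.
  congr _.+1; apply: eq_card => y; rewrite !inE A eqxx orbT.
  rewrite [j == k]eq_sym ?(negbTE kj) /= orbF.
  by have [->|] /= := eqVneq y k; rewrite ?addbF // ?(negbTE jk).
- move=> x xi xj; rewrite /degree.
  have [->|xk] := eqVneq x k; last first.
    by apply: eq_card => y; rewrite !inE A (negbTE xi) (negbTE xj) (negbTE xk) addbF.
  rewrite [LHS](cardsD1 j) [RHS](cardsD1 i) !inE A !eqxx ?orbT (adjC _ k i) ik /=.
  rewrite adjC ?(negbTE jk) ?(negbTE ki) ?(negbTE kj) /=; congr _.+1.
  apply: eq_card => y; rewrite !inE A !eqxx ?(negbTE ki) ?(negbTE kj) /=.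
  have [->|yj] /= := eqVneq y j; first by rewrite ji adjC ?(negbTE jk).
  have [->|yi] /= := eqVneq y i; first by rewrite adjC ik.
  by rewrite addbF.
- rewrite inE !A !eqxx ?orbT ?(negbTE jk) ik /= ki.
  by rewrite ?(negbTE ki) ?(negbTE kj).
rewrite [LHS](cardsD1 k) inE !A !eqxx ?orbT ?(negbTE jk) ik ?(negbTE ki) ?(negbTE kj) /=.
rewrite add1n; congr _.+1; apply: eq_card => y; rewrite !inE !A !eqxx ?orbT.
rewrite [i == k]eq_sym [j == k]eq_sym ?(negbTE ki) ?(negbTE kj) /= !orbF.
have [->|] /= := eqVneq y k; last by rewrite !addbF.
by rewrite ?(negbTE jk).
Qed.

(** A double count of the switchings that move an edge from [i] to [j].
    A graph [G] with degrees [f] admits [#|private G i j|] of them, and the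
    resulting graph [G'] admits [#|private G' j i|] reverse ones.  The
    first number is at least the second since [f j < f i].  Spreading the unit
    mass of each [G] evenly over its switchings, every [G'] therefore receives
    at most one unit. *)
Lemma with_degrees_switch_le (V : finType) (f g : V -> nat) (i j : V) :
  i != j -> (f j < f i)%N -> (g i).+1 = f i -> g j = (f j).+1 ->
  (forall x, x != i -> x != j -> g x = f x) ->
  (#|with_degrees f| <= #|with_degrees g|)%N.
Proof.
move=> ij fji gi gj gx.
suff : #|with_degrees f|%:R <= #|with_degrees g|%:R :> rat by rewrite ler_nat.
pose X (G : sgraph V) := private G i j; pose Y (G : sgraph V) := private G j i.
have F1 G : G \in with_degrees f -> (#|Y G| < #|X G|)%N.
  rewrite inE => /forallP h.
  have := private_degree G ij; rewrite (eqP (h i)) (eqP (h j)) => E.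
  by move: fji; rewrite /X /Y; lia.
have F2 G k : G \in with_degrees f -> k \in X G ->
    [/\ switch i j k G \in with_degrees g, k \in Y (switch i j k G)
      & (#|Y (switch i j k G)| <= #|X G|)%N].
  move=> Gf kX; have [d1 d2 d3 kY cY] := switch_degree ij kX.
  rewrite /Y cY; split=> //; last exact: F1.
  move: Gf; rewrite !inE => /forallP h; apply/forallP => x; apply/eqP.
  have [->|xi] := eqVneq x i; first by apply: succn_inj; rewrite d1 gi; apply/eqP.
  have [->|xj] := eqVneq x j; first by rewrite d2 gj (eqP (h j)).
  by rewrite d3 // gx //; apply/eqP.
have -> : #|with_degrees f|%:R = \sum_(G in with_degrees f)
    \sum_(k in X G) (#|X G|%:R)^-1 :> rat.
  rewrite -sum1_card natr_sum; apply: eq_bigr => G Gf.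
  rewrite sumr_const -[RHS]mulr_natl mulfV // pnatr_eq0.
  by have := F1 _ Gf; case: #|X G|.
have -> : \sum_(G in with_degrees f) \sum_(k in X G) (#|X G|%:R)^-1 =
   \sum_k \sum_(G | (G \in with_degrees f) && (k \in X G)) (#|X G|%:R)^-1 :> rat.
  by rewrite (exchange_big_dep predT).
apply: (@le_trans _ _ (\sum_k \sum_(G | (G \in with_degrees g) && (k \in Y G))
   (#|Y G|%:R)^-1)); last first.
  rewrite -(exchange_big_dep predT) //= -[#|with_degrees g|]sum1_card natr_sum.
  apply: ler_sum => G Gg; rewrite sumr_const -[leLHS]mulr_natl.
  have [->|c0] := eqVneq #|Y G| 0; first by rewrite mul0r.
  by rewrite mulfV // pnatr_eq0.
apply: ler_sum => k _.
have [/andP[ki kj]|] := boolP ((k != i) && (k != j)); last first.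
  rewrite negb_and !negbK => h; rewrite big_pred0 ?sumr_ge0 // => G.
  apply/negbTE/negP => /andP[_]; rewrite inE.
  by case/orP: h => /eqP ->; rewrite ?adjxx // eqxx !andbF.
rewrite [leRHS](reindex_inj (inv_inj (switchK ki kj))) /=.
rewrite [leRHS](bigID (fun G => (G \in with_degrees f) && (k \in X G))) /=.
apply: ler_wpDr; first by apply: sumr_ge0.
rewrite [leRHS](eq_bigl (fun G => (G \in with_degrees f) && (k \in X G))); last first.
  move=> G /=; apply: andb_idl => /andP[Gf kX].
  by have [-> ->] := F2 _ _ Gf kX.
apply: ler_sum => G /andP[Gf kX]; have [_ kY le] := F2 _ _ Gf kX.
rewrite lef_pV2 ?posrE ?ltr0n ?ler_nat //.
  exact: leq_ltn_trans (F1 _ Gf).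
by apply/card_gt0P; exists k.
Qed.

(** As long as [f] is not constant, a unit of degree can be moved from a vertex
    above the average to one below it; the distance [\sum_x |f x - d|] drops. *)
Lemma with_degrees_le_regular (V : finType) (d : nat) (f : V -> nat) :
  (\sum_x f x = #|V| * d)%N ->
  (#|with_degrees f| <= #|with_degrees (fun _ : V => d)|)%N.
Proof.
move E : (\sum_x ((f x - d) + (d - f x)))%N => m.
elim/ltn_ind: m f E => m IH f E sf.
have [/forallP h|/forallPn[x0 fx0]] := boolP [forall x, f x == d].
  apply: subset_leq_card; apply/fintype.subsetP => G; rewrite !inE => /forallP g.
  by apply/forallP => x; rewrite (eqP (g x)).
have sf' : (\sum_x f x = \sum_(x : V) d)%N by rewrite sum_nat_const.
have balance (a b : V -> nat) : (\sum_x a x = \sum_x b x)%N ->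
    (exists x, a x < b x)%N -> exists x, (b x < a x)%N.
  move=> ab [x xl]; apply/existsP; apply: contraT => /existsPn h.
  have : (\sum_x a x < \sum_x b x)%N; last by rewrite ab ltnn.
  rewrite (bigD1 x) //= [ltnRHS](bigD1 x) //= -addSn leq_add //.
  by apply: leq_sum => y _; rewrite leqNgt.
have [j jd] : exists j, (f j < d)%N.
  move: fx0; rewrite neq_ltn => /orP[?|?]; first by exists x0.
  by apply: (balance (fun=> d) f) => //; exists x0.
have [i id] : exists i, (d < f i)%N by apply: (balance f (fun=> d)) => //; exists j.
have ij : i != j by apply/eqP => e; move: id jd; rewrite e; lia.
pose g x := if x == i then (f i).-1 else if x == j then (f j).+1 else f x.
have gi : g i = (f i).-1 by rewrite /g eqxx.
have gj : g j = (f j).+1 by rewrite /g eq_sym (negbTE ij) eqxx.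
have gx x : x != i -> x != j -> g x = f x.
  by rewrite /g => /negbTE-> /negbTE->.
apply: (@leq_trans #|with_degrees g|).
  by apply: (with_degrees_switch_le ij) => //; rewrite ?gi; lia.
have ji : j != i by rewrite eq_sym.
apply: (IH (\sum_x ((g x - d) + (d - g x)))%N) => //.
  rewrite -E (bigD1 i) //= (bigD1 j) //= [ltnRHS](bigD1 i) //= [X in (_ < _ + X)%N](bigD1 j) //=.
  rewrite (eq_bigr (fun x => (f x - d) + (d - f x))%N); last first.
    by move=> x /andP[? ?]; rewrite gx.
  rewrite gi gj; lia.
rewrite -sf (bigD1 i) //= (bigD1 j) //= [RHS](bigD1 i) //= [X in (_ + X)%N = _]addnC.
rewrite [X in _ = (_ + X)%N](bigD1 j) //= (eq_bigr f); last first.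
  by move=> x /andP[? ?]; rewrite gx.
rewrite gi gj; lia.
Qed.

(** A graph on [n] vertices has one of at most [n ^ n] degree sequences, none of
    which is more frequent than the regular one. *)
Lemma count_regular_ge (n d m : nat) : (2 * m = n * d)%N ->
  ('C('C(n, 2), m) <= n ^ n * #|regular_graphs n d|)%N.
Proof.
move=> md.
have -> : 'C('C(n, 2), m) = #|[set G : sgraph 'I_n | #|edges G| == m]%SET|.
  rewrite (card_graphs (fun S : {set {set 'I_n}} => #|S| == m)).
  by rewrite cards_draws card_draws card_ord.
pose D (G : sgraph 'I_n) : {ffun 'I_n -> 'I_n} := [ffun x => Ordinal (degree_lt G x)].
rewrite -sum1_card (partition_big D predT) //=.
apply: (@leq_trans (\sum_(f : {ffun 'I_n -> 'I_n}) #|regular_graphs n d|)%N); last first.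
  by rewrite sum_nat_const card_ffun card_ord.
apply: leq_sum => f _; rewrite sum1_card.
have [/eqP sf|sf] := boolP (\sum_x (f x : nat) == n * d)%N.
  have := @with_degrees_le_regular _ d (fun x => f x : nat).
  rewrite card_ord => /(_ sf); apply: leq_trans; apply: subset_leq_card.
  apply/fintype.subsetP => G; move=> /andP[_ /eqP <-].
  by rewrite inE; apply/forallP => x; rewrite ffunE.
rewrite eq_card0 // => G; apply/negP => /andP[]; rewrite inE => /eqP cG /eqP DG.
case/negP: sf; rewrite -md -cG -handshake; apply/eqP/eq_bigr => x _.
by rewrite -DG ffunE.
Qed.

(** * Concentration for a uniformly random set of prescribed size *)

(** The binomial distribution with mean [m] (scaled by [N ^ N]) peaks at [m]:
    consecutive weights increase before [m] and decrease after it. *)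
Lemma binomial_mode (N m k : nat) : (m <= N)%N -> (k <= N)%N ->
  ('C(N, k) * ((N - m) ^ (N - k) * m ^ k) <=
   'C(N, m) * ((N - m) ^ (N - m) * m ^ m))%N.
Proof.
move=> mN kN.
pose f j := ('C(N, j) * ((N - m) ^ (N - j) * m ^ j))%N.
have up j : (j < m)%N -> (f j <= f j.+1)%N.
  move=> jm; rewrite -(leq_pmul2l (ltn0Sn j)) /f [leqRHS]mulnA mul_bin_left.
  rewrite (_ : N - j = (N - j.+1).+1)%N; last lia.
  rewrite !expnS.
  suff : (j.+1 * (N - m) <= (N - j.+1).+1 * m)%N.
    set c := 'C(N, j); set u := (m ^ j)%N; set v := ((N - m) ^ _)%N.
    move=> /(leq_mul (leqnn (c * u * v))); lia.
  apply: (@leq_trans (m * (N - m))); first by rewrite leq_mul.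
  by rewrite mulnC leq_mul //; lia.
have down j : (m <= j)%N -> (j < N)%N -> (f j.+1 <= f j)%N.
  move=> mj jN; rewrite -(leq_pmul2l (ltn0Sn j)) /f [leqLHS]mulnA mul_bin_left.
  rewrite (_ : N - j = (N - j.+1).+1)%N; last lia.
  rewrite !expnS.
  suff : ((N - j.+1).+1 * m <= j.+1 * (N - m))%N.
    set c := 'C(N, j); set u := (m ^ j)%N; set v := ((N - m) ^ _)%N.
    move=> /(leq_mul (leqnn (c * u * v))); lia.
  apply: (@leq_trans (m * (N - m))); last by rewrite leq_mul // ltnW.
  by rewrite mulnC leq_mul //; lia.
rewrite -/(f k) -/(f m); have [km|/ltnW mk] := leqP k m.
  have H r : (r <= m)%N -> (f (m - r)%N <= f m)%N.
    elim: r => [|r IH] rm; first by rewrite subn0.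
    apply: leq_trans (IH (ltnW rm)).
    by rewrite (_ : m - r = (m - r.+1).+1)%N; [apply: up|]; lia.
  by rewrite -(subKn km); apply: H; apply: leq_subr.
have H r : (m + r <= N)%N -> (f (m + r)%N <= f m)%N.
  elim: r => [|r IH] rm; first by rewrite addn0.
  by rewrite addnS; apply: leq_trans (down _ _ _) (IH _); lia.
by rewrite -(subnKC mk); apply: H; rewrite subnKC.
Qed.

(** The peak is one of [N + 1] weights of total mass 1. *)
Lemma binomial_mode_weight (R : realType) (N m : nat) :
  (0 < N)%N -> (m <= N)%N ->
  1 <= N.+1%:R * 'C(N, m)%:R * ((m%:R / N%:R) ^+ m * (1 - m%:R / N%:R) ^+ (N - m)) :> R.
Proof.
move=> N0 mN.
have N0' : N%:R != 0 :> R by rewrite pnatr_eq0 -lt0n.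
have -> : 1 - m%:R / N%:R = (N - m)%:R / N%:R :> R.
  by rewrite natrB // mulrBl divff.
rewrite !expr_div_n [X in _ * X]mulrACA -invfM -exprD subnKC //.
rewrite mulrA ler_pdivlMr ?exprn_gt0 ?ltr0n // mul1r.
rewrite -!natrX -!natrM ler_nat -[X in (X ^ _ <= _)%N](subnK mN) expnDn.
apply: (@leq_trans (\sum_(i < N.+1) 'C(N, m) * ((N - m) ^ (N - m) * m ^ m))%N).
  by apply: leq_sum => i _; apply: binomial_mode; rewrite // -ltnS.
by rewrite sum_nat_const card_ord mulnA [X in (_ <= _ * X)%N]mulnC.
Qed.

Lemma expR_le_quadratic (R : realType) (y : R) : y <= 1 / 2 ->
  expR y <= 1 + y + 2 * y ^+ 2.
Proof.
move=> y2; have := expR_ge1Dx (- y); rewrite expRN => h.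
have y1 : 0 < 1 - y by lra.
have e0 := expR_gt0 y.
have : expR y * (1 - y) <= 1.
  by apply: le_trans (ler_wpM2l (ltW e0) h) _; rewrite divff // gt_eqF.
move=> h1; rewrite -(ler_pM2r y1); apply: le_trans h1 _.
have : 0 <= y ^+ 2 * (1 - 2 * y) by rewrite mulr_ge0 ?sqr_ge0 //; lra.
rewrite -subr_ge0 => h2; rewrite -subr_ge0.
by rewrite (_ : _ - _ = y ^+ 2 * (1 - 2 * y) - 0) //; ring.
Qed.

Lemma bernoulli_mgf_le (R : realType) (p y : R) : 0 <= p <= 1 -> y <= 1 / 2 ->
  p * expR y + (1 - p) <= expR (p * y + 2 * y ^+ 2).
Proof.
move=> /andP[p0 p1] y2; apply: le_trans (expR_ge1Dx _).
have h := ler_wpM2l p0 (expR_le_quadratic y2).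
have : p * y ^+ 2 <= y ^+ 2 by rewrite ler_piMl // sqr_ge0.
by lra.
Qed.

(** A random set that contains each element of [E] independently with
    probability [m / N] has [m] elements with probability at least [1 / (N + 1)]
    and is then uniform.  So moments of the uniform [m]-subset cost at most a
    factor [N + 1] over moments of independent choices, which factorize. *)
Lemma uniform_subset_mgf (R : realType) (T : finType) (E : {set T}) (N m : nat)
    (y : T -> R) :
  #|E| = N -> (0 < N)%N -> (m <= N)%N -> (forall e, e \in E -> y e <= 1 / 2) ->
  \sum_(S : {set T} | (S \subset E) && (#|S| == m)) expR (\sum_(e in S) y e) <=
  N.+1%:R * 'C(N, m)%:R *
    expR (m%:R / N%:R * (\sum_(e in E) y e) + 2 * \sum_(e in E) y e ^+ 2).
Proof.
move=> NE E0 mE yh; set p := m%:R / N%:R.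
have N0 : 0 < N%:R :> R by rewrite ltr0n.
have p01 : 0 <= p <= 1.
  by rewrite divr_ge0 //= ler_pdivrMr // mul1r ler_nat.
have [p0 p1] := andP p01.
have q0 : 0 <= 1 - p by rewrite subr_ge0.
set w := p ^+ m * (1 - p) ^+ (N - m).
have w0 : 0 <= w by rewrite mulr_ge0 // exprn_ge0.
set X := \sum_(S | _) _.
have X0 : 0 <= X by apply: sumr_ge0 => S _; apply: expR_ge0.
have wX : X * w <= expR (p * (\sum_(e in E) y e) + 2 * \sum_(e in E) y e ^+ 2).
  (* Outside [E] the factors 0 and 1 restrict the expansion to subsets of [E]. *)
  pose F e : R := if e \in E then p * expR (y e) else 0.
  pose G e : R := if e \in E then 1 - p else 1.
  have FG0 (S : {set T}) : 0 <= \prod_e (if e \in S then F e else G e).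
    apply: prodr_ge0 => e _; rewrite /F /G; case: ifP => _; case: ifP => _ //.
    by rewrite mulr_ge0 // expR_ge0.
  apply: (@le_trans _ _ (\prod_e (F e + G e))); last first.
    rewrite (bigID (mem E)) /= [X in _ * X]big1 ?mulr1; last first.
      by move=> e /negbTE eE; rewrite /F /G eE add0r.
    rewrite 2!mulr_sumr -big_split expR_sum; apply: ler_prod => e eE.
    rewrite /F /G eE bernoulli_mgf_le ?yh // andbT.
    by rewrite addr_ge0 // mulr_ge0 // expR_ge0.
  rewrite (@bigA_distr R 0 1 (GRing.mul : Monoid.mul_law 0)
     (GRing.add : Monoid.add_law 0 _)).
  rewrite mulr_suml.
  rewrite [leRHS](bigID (fun S : {set T} => (S \subset E) && (#|S| == m))) /=.
  apply: ler_wpDr; first by apply: sumr_ge0.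
  apply: ler_sum => S /andP[SE /eqP Sm].
  rewrite [leRHS](bigID (mem S)) /= /w mulrA ler_pM //.
  - by rewrite mulr_ge0 ?expR_ge0 ?exprn_ge0.
  - by rewrite exprn_ge0.
  - rewrite [leRHS](eq_bigr (fun e => p * expR (y e))); last first.
      by move=> e eS; rewrite eS /F (fintype.subsetP SE).
    by rewrite [leRHS]big_split prodr_const Sm /= expR_sum mulrC.
  rewrite (eq_bigr G); last by move=> e /negbTE ->.
  rewrite (bigID (mem E)) /= [X in _ * X]big1 ?mulr1; last first.
    by move=> e /andP[_ /negbTE eE]; rewrite /G eE.
  rewrite (eq_bigr (fun=> 1 - p)); last by move=> e /andP[_ eE]; rewrite /G eE.
  rewrite (eq_bigl (mem (E :\: S)%SET)); last by move=> e; rewrite /= inE.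
  by rewrite prodr_const cardsD (finset.setIidPr SE) Sm NE.
apply: le_trans (ler_wpM2l _ wX); last by rewrite mulr_ge0.
rewrite mulrC -[leLHS]mulr1 -mulrA ler_wpM2l // mulrC.
exact: binomial_mode_weight.
Qed.

(** Markov's inequality for the exponential of the sum. *)
Lemma uniform_subset_tail1 (R : realType) (T : finType) (E : {set T}) (N m : nat)
    (y : T -> R) (t : R) :
  #|E| = N -> (0 < N)%N -> (m <= N)%N -> (forall e, e \in E -> y e <= 1 / 2) ->
  #|[set S : {set T} | [&& S \subset E, #|S| == m &
      m%:R / N%:R * (\sum_(e in E) y e) + t < \sum_(e in S) y e]]%SET|%:R <=
  N.+1%:R * 'C(N, m)%:R * expR (2 * (\sum_(e in E) y e ^+ 2) - t).
Proof.
move=> NE E0 mE yh; set M := m%:R / N%:R * _.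
have := uniform_subset_mgf NE E0 mE yh; rewrite -/M => h.
rewrite (_ : 2 * _ - t = (M + 2 * (\sum_(e in E) y e ^+ 2)) - (M + t)); last by ring.
rewrite expRD expRN mulrA ler_pdivlMr ?expR_gt0 //; apply: le_trans h.
rewrite -sum1_card natr_sum mulr_suml big_mkcond [leRHS]big_mkcond /=.
apply: ler_sum => S _; rewrite inE.
case: (_ \subset _) => //=; case: (#|S| == m) => //=; case: ifP => [/ltW lt|_]; last exact: expR_ge0.
by rewrite mul1r ler_expR.
Qed.

(** The exponential moment is taken at [l = beta / (2 sigma)].  The bound on the
    moments needs [l <= 1 / 4]; otherwise [sigma < 2 beta], and then the
    total mass of [a] is at most [beta * sigma], so that no deviation occurs. *)
Lemma uniform_subset_tail (R : realType) (T : finType) (E : {set T}) (N m : nat)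
    (a : T -> R) (beta sigma : R) :
  #|E| = N -> (0 < N)%N -> (m <= N)%N -> (forall e, e \in E -> 0 <= a e <= 2) ->
  0 < beta -> 0 <= sigma -> 4 * (\sum_(e in E) a e) <= sigma ^+ 2 ->
  #|[set S : {set T} | [&& S \subset E, #|S| == m &
      beta * sigma < `|\sum_(e in S) a e - m%:R / N%:R * \sum_(e in E) a e| ]]%SET|%:R
   <= 2 * (N.+1%:R * 'C(N, m)%:R * expR (- (beta ^+ 2 / 4))).
Proof.
move=> NE E0 mE ah b0 s0 Ms; set M := \sum_(e in E) a e; set p := m%:R / N%:R.
have N0 : 0 < N%:R :> R by rewrite ltr0n.
have p0 : 0 <= p by rewrite divr_ge0.
have p1 : p <= 1 by rewrite ler_pdivrMr // mul1r ler_nat.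
have M0 : 0 <= M by apply: sumr_ge0 => e /ah /andP[].
have [sb|sb] := ltP sigma (2 * beta).
  rewrite (_ : [set S | _]%SET = finset.set0); last first.
    apply/setP => S; rewrite !inE; apply/negbTE/negP => /and3P[SE _].
    have S0 : 0 <= \sum_(e in S) a e.
      by apply: sumr_ge0 => e /(fintype.subsetP SE)/ah /andP[].
    have SM : \sum_(e in S) a e <= M.
      rewrite /M [leRHS](bigID (mem S)) /= (eq_bigl (fun e => (e \in E) && (e \in S))).
        by rewrite lerDl; apply: sumr_ge0 => e /andP[/ah /andP[]].
      by move=> e; rewrite /= andb_idl // => /(fintype.subsetP SE).
    have pM0 : 0 <= p * M by rewrite mulr_ge0.
    have pM1 : p * M <= M by rewrite ler_piMl.
    have sM : M <= beta * sigma.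
      have : sigma ^+ 2 <= 2 * beta * sigma by rewrite expr2 ler_wpM2r // ltW.
      have : 0 <= beta * sigma by rewrite mulr_ge0 // ltW.
      rewrite -/M in Ms; lra.
    by rewrite ltNge => /negP; apply; rewrite ler_norml; apply/andP; split; lra.
  by rewrite cards0 !mulr_ge0 // ?expR_ge0 // addr_ge0.
have s1 : 0 < sigma by lra.
pose l := beta / (2 * sigma).
have l0 : 0 < l by rewrite divr_gt0 // mulr_gt0.
have l1 : l <= 1 / 4 by rewrite ler_pdivrMr; lra.
have ls : l * sigma = beta / 2 by rewrite /l; field; rewrite gt_eqF.
have side (z : R) : z = 1 \/ z = -1 ->
    #|[set S : {set T} | [&& S \subset E, #|S| == m &
      p * (\sum_(e in E) (z * l * a e)) + beta * (beta / 2)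
        < \sum_(e in S) (z * l * a e)]]%SET|%:R
    <= N.+1%:R * 'C(N, m)%:R * expR (- (beta ^+ 2 / 4)).
  move=> hz; have zle (x : R) : 0 <= x -> z * x <= x by case: hz => ->; lra.
  have z2 : z ^+ 2 = 1 by case: hz => ->; rewrite ?sqrrN expr1n.
  apply: le_trans (uniform_subset_tail1 _ NE E0 mE _) _.
    move=> e /ah /andP[a0 a2]; rewrite -mulrA.
    apply: le_trans (zle _ (mulr_ge0 (ltW l0) a0)) _.
    by apply: le_trans (ler_pM (ltW l0) a0 l1 a2) _; lra.
  rewrite ler_wpM2l ?mulr_ge0 // ler_expR.
  have h : \sum_(e in E) (z * l * a e) ^+ 2 <= l ^+ 2 * (2 * M).
    rewrite 2!mulr_sumr; apply: ler_sum => e /ah /andP[a0 a2].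
    rewrite (_ : _ ^+ 2 = z ^+ 2 * (l ^+ 2 * a e ^+ 2)); last by ring.
    rewrite z2 mul1r ler_wpM2l ?sqr_ge0 //.
    by rewrite [a e ^+ 2]expr2 ler_wpM2r.
  have h2 : l ^+ 2 * (4 * M) <= (beta / 2) ^+ 2.
    rewrite -ls (_ : (l * sigma) ^+ 2 = l ^+ 2 * sigma ^+ 2); last by ring.
    by rewrite ler_wpM2l // sqr_ge0.
  rewrite (_ : beta * _ = beta ^+ 2 / 2); last by rewrite expr2; field.
  move: h2; rewrite (_ : (beta / 2) ^+ 2 = beta ^+ 2 / 4); last by field.
  lra.
apply: le_trans (_ : _ <= #|([set S : {set T} | [&& S \subset E, #|S| == m &
      p * (\sum_(e in E) (1 * l * a e)) + beta * (beta / 2)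
        < \sum_(e in S) (1 * l * a e)]] :|: [set S : {set T} | [&& S \subset E, #|S| == m &
      p * (\sum_(e in E) (-1 * l * a e)) + beta * (beta / 2)
        < \sum_(e in S) (-1 * l * a e)]])%SET|%:R) _; last first.
  rewrite mulr_natl mulr2n.
  apply: le_trans (lerD (side 1 _) (side (-1) _)); [|by left|by right].
  by rewrite -natrD ler_nat cardsU leq_subr.
rewrite ler_nat; apply: subset_leq_card; apply/fintype.subsetP => S.
rewrite !inE => /and3P[-> -> /=]; rewrite -!mulr_sumr.
set s := \sum_(e in S) a e; rewrite ltr_normr -ls -/M.
case/orP => h; apply/orP; [left|right].
  by rewrite -(ltr_pM2l l0) in h; lra.
by rewrite -(ltr_pM2l l0) in h; lra.
Qed.

(** * Jumbledness of random regular graphs *)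

Definition crossing (V : finType) (S : {set {set V}}) (A B : {set V}) : nat :=
  (\sum_(x in A) \sum_(y in B) ([set x; y]%SET \in S))%N.

Definition jumbled (R : realType) (V : finType) (p b : R) (G : sgraph V) : bool :=
  [forall A : {set V}, forall B : {set V},
    `|(crossing (edges G) A B)%:R - p * (#|A|%:R * #|B|%:R)|
      <= b * (#|A| + #|B|)%:R].

Lemma natrM4_le_sqrD (R : realType) (a b : nat) :
  4 * (a%:R * b%:R) <= (a + b)%:R ^+ 2 :> R.
Proof.
rewrite natrD -subr_ge0 (_ : _ - _ = (a%:R - b%:R) ^+ 2 :> R) ?sqr_ge0 //.
by ring.
Qed.

Lemma crossing_pairs (V : finType) (A B : {set V}) :
  crossing (pairs V) A B = (#|A| * #|B| - #|A :&: B|)%N.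
Proof.
have -> : crossing (pairs V) A B = (\sum_(x in A) (#|B| - (x \in B)))%N.
  apply: eq_bigr => x _; rewrite (cardsD1 x) addKn -sum1_card.
  rewrite big_mkcond [RHS]big_mkcond /=; apply: eq_bigr => y _.
  by rewrite pairsE !inE eq_sym; case: (y \in B); case: (_ == _).
have -> : (#|A :&: B| = \sum_(x in A) (x \in B))%N.
  rewrite -big_mkcondr sum1_card; apply: eq_card => x; rewrite inE //.
have le x : ((x \in B : nat) <= #|B|)%N.
  by case xB: (x \in B) => //; rewrite card_gt0; apply/set0Pn; exists x.
have : (\sum_(x in A) (#|B| - (x \in B)) + \sum_(x in A) (x \in B) = #|A| * #|B|)%N.
  by rewrite -big_split -sum_nat_const; apply: eq_bigr => x _; rewrite /= subnK.
by move=> <-; rewrite addnK.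
Qed.

Definition crossing_at (V : finType) (A B : {set V}) (e : {set V}) : nat :=
  (\sum_(x in A) \sum_(y in B) ([set x; y]%SET == e))%N.

(** For fixed [A] and [B] the number of crossing pairs is a sum over the edges
    of weights in [{0, 1, 2}]: a linear statistic of the random edge set. *)
Lemma crossingE (V : finType) (S : {set {set V}}) (A B : {set V}) :
  crossing S A B = (\sum_(e in S) crossing_at A B e)%N.
Proof.
rewrite /crossing_at exchange_big; apply: eq_bigr => x _ /=.
rewrite exchange_big; apply: eq_bigr => y _ /=.
case yS: (_ \in S).
  by rewrite (bigD1 _ yS) /= eqxx big1 // => e /andP[_ /negbTE ne]; rewrite eq_sym ne.
by rewrite big1 // => e eS; case: eqP => // E; rewrite E eS in yS.
Qed.

Lemma crossing_at_le2 (V : finType) (A B e : {set V}) : e \in pairs V ->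
  (crossing_at A B e <= 2)%N.
Proof.
rewrite inE => /cards2P[u [v [uv ->]]].
apply: (@leq_trans (\sum_x \sum_y ((x == u) * (y == v) + (x == v) * (y == u))))%N.
  rewrite /crossing_at big_mkcond; apply: leq_sum => x _; case: ifP => // _.
  rewrite big_mkcond; apply: leq_sum => y _; case: ifP => // _.
  rewrite eq_pair.
  by case: (x == u); case: (x == v); case: (y == u); case: (y == v).
have delta (w : V) : (\sum_x (x == w) = 1)%N.
  by rewrite (bigD1 w) //= eqxx big1 // => x /negbTE->.
rewrite (eq_bigr (fun x => (x == u) + (x == v)))%N => [|x _].
  by rewrite big_split /= !delta.
by rewrite big_split -!big_distrr /= !delta !muln1.
Qed.

(** The edge density is [d / (n - 1)], and only pairs of distinct vertices can
    be adjacent.  Replacing this exact mean by [d / n * |A| * |B|] changes it by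
    at most [|A| + |B|]. *)
Lemma jumbled_from_centered (R : realType) (n d : nat) (c : R) (G : sgraph 'I_n)
    (A B : {set 'I_n}) :
  (1 < n)%N -> (d < n)%N ->
  `|(crossing (edges G) A B)%:R
     - d%:R / (n.-1)%:R * (crossing (pairs 'I_n) A B)%:R| <= c * (#|A| + #|B|)%:R ->
  `|(crossing (edges G) A B)%:R - d%:R / n%:R * (#|A|%:R * #|B|%:R)|
     <= (c + 1) * (#|A| + #|B|)%:R :> R.
Proof.
move=> n1 dn.
have n0 : 0 < n%:R :> R by rewrite ltr0n ltnW.
have m0 : 0 < n.-1%:R :> R by rewrite ltr0n -ltnS prednK // ltnW.
have cB : (#|A :&: B| <= #|B|)%N by rewrite subset_leq_card // finset.subsetIr.
have cA : (#|A :&: B| <= #|A|)%N by rewrite subset_leq_card // finset.subsetIl.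
have cAB : (#|A :&: B| <= #|A| * #|B|)%N.
  by case: (posnP #|B|) cB cA => [-> + _|B0 _ cA]; rewrite ?muln0 //;
     apply: (leq_trans cA); rewrite leq_pmulr.
have Bn : (#|B| <= n)%N by rewrite -[leqRHS]card_ord max_card.
rewrite crossing_pairs natrB // natrM.
set q : R := d%:R / n.-1%:R; set p : R := d%:R / n%:R.
set a : R := #|A|%:R; set b : R := #|B|%:R; set i : R := #|A :&: B|%:R.
rewrite natrD -/a -/b; set e : R := (crossing _ _ _)%:R => h.
have i0 : 0 <= i by []. have ib : i <= b by rewrite ler_nat.
have a0 : 0 <= a by []. have b0 : 0 <= b by [].
have bn : b <= n%:R by rewrite ler_nat.
have dm : d%:R <= n.-1%:R :> R by rewrite ler_nat -ltnS prednK // ltnW.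
have nm : n%:R = n.-1%:R + 1 :> R by rewrite natr1 prednK // ltnW.
have q0 : 0 <= q by rewrite divr_ge0.
have q1 : q <= 1 by rewrite ler_pdivrMr // mul1r.
have qp : q - p = q / n%:R.
  by rewrite /q /p nm; field; rewrite -nm !gt_eqF.
have qi : 0 <= q * i <= b.
  by rewrite mulr_ge0 //=; apply: le_trans ib; rewrite ler_piMl.
have qab : 0 <= (q - p) * (a * b) <= a.
  rewrite qp; apply/andP; split; first by rewrite !mulr_ge0 // invr_ge0.
  rewrite (_ : _ * _ = q * (a * (b / n%:R))); last by field; rewrite gt_eqF.
  apply: (@le_trans _ _ (a * (b / n%:R))).
    by rewrite ler_piMl // !mulr_ge0 // invr_ge0.
  rewrite ler_piMr //.
  by rewrite ler_pdivrMr // mul1r.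
have -> : e - p * (a * b) = (e - q * (a * b - i)) + ((q - p) * (a * b) - q * i).
  by ring.
apply: le_trans (ler_normD _ _) _; rewrite [leRHS]mulrDl mul1r lerD //.
by rewrite ler_norml; lra.
Qed.

Lemma union_bound_size (n N : nat) : (3 < n)%N -> (2 * N = n * n.-1)%N ->
  (n * (4 ^ n * (2 * N.+1) * n ^ n) <= n ^ (4 * n))%N.
Proof.
move=> n3 N2.
have h1 : (4 ^ n <= n ^ n)%N by rewrite leq_exp2r //; lia.
have h2 : (2 * N.+1 <= n ^ 2)%N.
  by rewrite mulnS N2 -[n in (_ <= n ^ 2)%N]prednK; [rewrite -mulnn; nia | lia].
have h3 : (n ^ (2 * n + 3) <= n ^ (4 * n))%N by rewrite leq_exp2l; lia.
apply: leq_trans h3.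
rewrite (_ : n ^ (2 * n + 3) = n * (n ^ n * n ^ 2 * n ^ n))%N.
  by rewrite leq_mul2l leq_mul ?orbT // leq_mul.
by rewrite mul2n -addnn !expnD expnSr; lia.
Qed.

(** Union bound over [A] and [B].  With [beta = 4 sqrt n ln n], a fixed pair fails
    with probability below [n ^ (- 4 n)] up to polynomial factors.  This absorbs
    the [4 ^ n] pairs and the factor [n ^ n] lost in passing from all graphs
    with [m] edges to regular graphs. *)
Lemma unif_pr_not_jumbled (R : realType) (n d : nat) :
  (3 < n)%N -> 1 <= ln n%:R :> R -> regular_graphs n d != finset.set0 ->
  unif_pr R (regular_graphs n d)
    [pred G | ~~ jumbled (d%:R / n%:R : R) (5 * (Num.sqrt n%:R * ln n%:R)) G]
  <= n%:R^-1.
Proof.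
move=> n3 L1 /set0Pn[G0 G0reg].
have n0 : 0 < n%:R :> R by rewrite ltr0n; lia.
set L : R := ln n%:R in L1 *.
set m := #|edges G0|.
have md : (2 * m = n * d)%N.
  rewrite -handshake -[n in RHS]card_ord -sum_nat_const; apply: eq_bigr => x _.
  by move: G0reg; rewrite inE => /forallP/(_ x)/eqP.
have dn : (d < n)%N.
  have x0 : 'I_n by exists 0; lia.
  by move: G0reg; rewrite inE => /forallP/(_ x0)/eqP <-; apply: degree_lt.
set N := 'C(n, 2).
have NE : #|pairs 'I_n| = N by rewrite card_draws card_ord.
have N2 : (2 * N = n * n.-1)%N.
  by rewrite -mul_bin_diag bin1.
have mN : (m <= N)%N by rewrite -NE subset_leq_card // edgesP.
have N0 : (0 < N)%N by rewrite bin_gt0; lia.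
have mNd : (m * n.-1 = d * N)%N.
  apply/eqP; rewrite -(eqn_pmul2l (ltn0Sn 1)) mulnA md [(2 * (d * N))%N]mulnCA N2.
  by rewrite mulnAC mulnC.
have mNq : m%:R / N%:R = d%:R / n.-1%:R :> R.
  apply/eqP; rewrite eqr_div ?pnatr_eq0 -?lt0n //; last by lia.
  by rewrite -!natrM mNd.
have sq1 : 1 <= Num.sqrt n%:R :> R.
  by rewrite -[leLHS]sqrtr1 ler_wsqrtr ?ler1n ?(ltnW (ltnW (ltnW n3))).
set s : R := Num.sqrt n%:R in sq1 *.
have s2 : s ^+ 2 = n%:R by rewrite sqr_sqrtr.
have sL : 1 <= s * L by rewrite -[1]mulr1 ler_pM.
set beta := 4 * (s * L).
have beta0 : 0 < beta by rewrite mulr_gt0 //; lra.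
set K := 2 * (N.+1%:R * 'C(N, m)%:R * expR (- (beta ^+ 2 / 4))).
(* The edge sets for which [A] and [B] violate the concentration bound. *)
pose Z (A B : {set 'I_n}) := [set S : {set {set 'I_n}} |
  [&& S \subset pairs 'I_n, #|S| == m & beta * (#|A| + #|B|)%:R <
   `|\sum_(e in S) (crossing_at A B e)%:R -
     m%:R / N%:R * \sum_(e in pairs 'I_n) (crossing_at A B e)%:R| ]]%SET.
have ZK A B : #|Z A B|%:R <= K.
  apply: uniform_subset_tail => //.
    move=> e /(crossing_at_le2 A B) le2; apply/andP; split; first exact: ler0n.
    by rewrite (ler_nat R _ 2).
  rewrite -natr_sum -crossingE crossing_pairs.
  apply: le_trans (natrM4_le_sqrD _ _ _); rewrite ler_wpM2l // -natrM ler_nat.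
  exact: leq_subr.
set bad := [set G in regular_graphs n d | ~~ jumbled (d%:R / n%:R : R) (5 * (s * L)) G]%SET.
have badZ : (#|bad| <= \sum_A \sum_B #|Z A B|)%N.
  rewrite -(card_imset _ (@val_inj _ _ (sgraph 'I_n))) /= -sum1_card.
  under [leqRHS]eq_bigr do under eq_bigr do rewrite -sum1_card big_mkcond.
  rewrite (eq_bigr _ (fun A _ => exchange_big _ _ _ _ _ _)) exchange_big big_mkcond.
  apply: leq_sum => S _; case: ifP => // /imsetP[G Gbad ->].
  move: Gbad; rewrite inE => /andP[Greg /forallPn[A /forallPn[B AB]]].
  rewrite (bigD1 A) //= (bigD1 B) //= ifT // inE edgesP /=.
  have -> /= : #|edges G| == m.
    rewrite -(eqn_pmul2l (ltn0Sn 1)) md -handshake -[n in (n * d)%N]card_ord.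
    rewrite -sum_nat_const; apply/eqP/eq_bigr => x _.
    by move: Greg; rewrite inE => /forallP/(_ x)/eqP.
  rewrite ltNge; apply: contra AB; rewrite -!natr_sum -!crossingE mNq => h.
  apply: le_trans (jumbled_from_centered _ dn h) _; first by lia.
  by rewrite ler_wpM2r // /beta; lra.
have K0 : 0 <= K by rewrite !mulr_ge0 // expR_ge0.
have bad1 : #|bad|%:R <= (4 ^ n)%:R * K.
  apply: (@le_trans _ _ (\sum_(A : {set 'I_n}) \sum_(B : {set 'I_n}) K)).
    apply: le_trans (_ : (\sum_A \sum_B #|Z A B|)%:R <= _); first by rewrite ler_nat.
    rewrite natr_sum; apply: ler_sum => A _; rewrite natr_sum.
    by apply: ler_sum => B _; apply: ZK.
  have cI : #|{set 'I_n}| = (2 ^ n)%N.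
    by rewrite -cardsT -powersetT card_powerset cardsT card_ord.
  by rewrite !sumr_const cI -mulrnA -[leLHS]mulr_natl -expnMn.
have CReg : 'C(N, m)%:R <= (n ^ n * #|regular_graphs n d|)%:R :> R.
  by rewrite ler_nat count_regular_ge.
have expn : expR (- (beta ^+ 2 / 4)) <= (n ^ (4 * n))%:R^-1 :> R.
  apply: (@le_trans _ _ (expR (- ((4 * n)%:R * L)))).
    rewrite ler_expR lerN2 (_ : beta ^+ 2 / 4 = 4 * (s ^+ 2) * L ^+ 2); last first.
      by rewrite /beta; field.
    rewrite s2 natrM ler_wpM2l ?mulr_ge0 //.
    by rewrite expr2 ler_peMr //; lra.
  by rewrite expRN expRM_natl lnK ?posrE // natrX.
rewrite /unif_pr -/bad ler_pdivrMr; last first.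
  by rewrite ltr0n; apply/card_gt0P; exists G0.
apply: le_trans bad1 _; rewrite /K.
set Rg := #|regular_graphs n d| in CReg *.
have pn0 : 0 < (n ^ (4 * n))%:R :> R by rewrite ltr0n expn_gt0 -(ltr0n R) n0.
apply: (@le_trans _ _ ((4 ^ n)%:R * (2 * (N.+1%:R * (n ^ n * Rg)%:R * (n ^ (4 * n))%:R^-1)))).
  rewrite ler_wpM2l // ler_wpM2l // ler_pM ?expR_ge0 ?mulr_ge0 //.
  by rewrite ler_wpM2l.
rewrite !mulrA ler_pdivrMr // -[leRHS]mulrA ler_pdivlMl //.
rewrite -!natrM ler_nat.
rewrite [(n * _)%N](_ : _ = n * (4 ^ n * (2 * N.+1) * n ^ n) * Rg)%N; last first.
  by rewrite !mulnA.
by rewrite [leqRHS]mulnC leq_mul2r union_bound_size ?orbT.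
Qed.

(** * Counting constrained maps in a jumbled graph *)

(** Resampling the value at [i]: averages over maps can be computed by fixing a
    map and averaging over its value at [i], which avoids splitting the index
    type. *)
Definition upd (K V : finType) (f : {ffun K -> V}) (i : K) (x : V) : {ffun K -> V} :=
  [ffun k => if k == i then x else f k].

(** [(f, x) |-> (upd f i x, f i)] is an involution. *)
Lemma sum_upd (R : comNzRingType) (I V : finType) (phi : {ffun I -> V} -> R) (i : I) :
  #|V|%:R * (\sum_f phi f) = \sum_f \sum_x phi (upd f i x).
Proof.
pose h (u : {ffun I -> V} * V) := (upd u.1 i u.2, u.1 i).
have hK : involutive h.
  move=> [f x]; rewrite /h /=; congr (_, _); last by rewrite ffunE eqxx.
  by apply/ffunP => k; rewrite !ffunE; case: eqP => [->|].
rewrite (pair_big predT predT) /= (reindex_inj (inv_inj hK)) /=.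
rewrite (eq_bigr (fun u : {ffun I -> V} * V => phi u.1)); last first.
  move=> [f x] _ /=; congr phi.
  by apply/ffunP => k; rewrite !ffunE; case: eqP => [->|].
rewrite -(pair_big predT predT (fun f _ => phi f)) /= mulr_sumr.
by apply: eq_bigr => f _; rewrite sumr_const mulr_natl.
Qed.

Definition sat (I V : finType) (g : I * I -> rel V) (F : {set I * I})
    (f : {ffun I -> V}) : bool :=
  [forall k in F, g k (f k.1) (f k.2)].

Definition touching (I : finType) (i : I) (F : {set I * I}) : {set I * I} :=
  [set k in F | (k.1 == i) || (k.2 == i)]%SET.

Definition avoiding (I : finType) (i : I) (F : {set I * I}) : {set I * I} :=
  [set k in F | (k.1 != i) && (k.2 != i)]%SET.

Lemma satU (I V : finType) (g : I * I -> rel V) (F G : {set I * I}) f :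
  sat g (F :|: G)%SET f = sat g F f && sat g G f.
Proof.
apply/forall_inP/andP => [h|[/forall_inP hF /forall_inP hG] k].
  by split; apply/forall_inP => k kF; apply: h; rewrite inE kF ?orbT.
by rewrite inE => /orP[]; [apply: hF|apply: hG].
Qed.

Lemma eq_sat (I V : finType) (g : I * I -> rel V) (F : {set I * I})
    (f f' : {ffun I -> V}) :
  (forall k, k \in F -> f k.1 = f' k.1 /\ f k.2 = f' k.2) ->
  sat g F f = sat g F f'.
Proof.
move=> h; apply/forall_inP/forall_inP => s k kF; have := s k kF;
  by have [-> ->] := h k kF.
Qed.

Definition sat_count (R : realType) (I V : finType) (g : I * I -> rel V)
  (F : {set I * I}) : R := \sum_(f : {ffun I -> V}) (sat g F f)%:R.

(** Resample the values at [i] and at [j], the other values being given by [f].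
    A constraint of [F] other than [(i, j)] involves at most one of [i] and [j],
    so they confine the two new values to independent sets [A f] and [B f], and
    the hypothesis applies to the pair [(i, j)].  The sum of [|A f|] over the
    [f] whose constraints away from [i] and [j] hold counts the maps that
    satisfy [avoiding j F]. *)
Lemma sat_remove_pair (R : realType) (s : nat) (V : finType)
    (g : 'I_s * 'I_s -> rel V) (F : {set 'I_s * 'I_s}) (i j : 'I_s) (p b : R) :
  (0 < #|V|)%N ->
  (forall k, k \in F -> (k.1 < k.2)%N) -> (i, j) \in F ->
  (forall A B : {set V},
    `|\sum_(x in A) \sum_(y in B) (g (i, j) x y)%:R - p * (#|A|%:R * #|B|%:R)|
      <= b * (#|A| + #|B|)%:R) ->
  #|V|%:R * `|sat_count R g F - p * sat_count R g (F :\ (i, j))%SET|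
    <= b * (sat_count R g (avoiding i F) + sat_count R g (avoiding j F)).
Proof.
move=> V0 Flt ijF disc; have n0 : 0 < #|V|%:R :> R by rewrite ltr0n.
have ij : i != j by have := Flt _ ijF; rewrite /= ltn_neqAle => /andP[].
pose F' := (F :\ (i, j))%SET.
pose C f := sat g (avoiding i (avoiding j F)) f.
pose A (f : {ffun 'I_s -> V}) := [set x | sat g (touching i F') (upd f i x)]%SET.
pose B (f : {ffun 'I_s -> V}) := [set y | sat g (touching j F') (upd f j y)]%SET.
(* Since [i < j] and all pairs of [F] are increasing, [(i, j)] is the only pair
   of [F] that involves both [i] and [j]. *)
have F'P k : k \in F' -> ~~ [&& (k.1 == i) || (k.2 == i) & (k.1 == j) || (k.2 == j)].
  case: k => a c; rewrite !inE /= => /andP[ne acF]; have := Flt _ acF => /= ac.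
  have := Flt _ ijF => /= lij.
  apply: contra ne => /andP[/orP[]/eqP ? /orP[]/eqP ?]; subst; rewrite ?eqxx //;
    by exfalso; lia.
have satF' f x y : sat g F' (upd (upd f i x) j y) = [&& C f, x \in A f & y \in B f].
  have -> : F' = (avoiding i (avoiding j F) :|: (touching i F' :|: touching j F'))%SET.
    apply/setP => k; rewrite !inE; case kF: (k \in F) => /=; rewrite ?andbF ?andbT //.
    have [->|ne] := eqVneq k (i, j); first by rewrite /= !eqxx /= ?andbF.
    by case: (k.1 == i); case: (k.2 == i); case: (k.1 == j); case: (k.2 == j).
  rewrite !satU !inE; congr [&& _, _ & _]; apply: eq_sat => k; rewrite !inE !ffunE.
  - case/andP=> /andP[_ /andP[/negbTE -> /negbTE ->]] /andP[/negbTE -> /negbTE ->] //.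
  - case/andP=> kF' ti; have := F'P k; rewrite !inE kF' ti => /(_ isT) /=.
    by rewrite negb_or => /andP[/negbTE -> /negbTE ->].
  case/andP=> kF' tj; have := F'P k; rewrite !inE kF' tj andbT => /(_ isT) /=.
  by rewrite negb_or => /andP[/negbTE -> /negbTE ->].
have satF f x y : sat g F (upd (upd f i x) j y) =
    g (i, j) x y && sat g F' (upd (upd f i x) j y).
  rewrite -[in LHS](finset.setD1K ijF) satU; congr (_ && _).
  apply/forall_inP/idP => [h|gxy k].
    by have := h (i, j); rewrite !inE eqxx !ffunE /= eqxx (negbTE ij) eqxx; apply.
  by rewrite inE => /eqP -> /=; rewrite !ffunE /= !eqxx (negbTE ij).
have cA f : (C f)%:R * #|A f|%:R = \sum_x (sat g (avoiding j F) (upd f i x))%:R :> R.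
  rewrite -sum1_card natr_sum mulr_sumr big_mkcond; apply: eq_bigr => x _.
  rewrite (_ : avoiding j F = avoiding i (avoiding j F) :|: touching i F')%SET; last first.
    apply/setP => k; rewrite !inE; case kF: (k \in F); rewrite /= ?andbF //.
    have [->|ne] := eqVneq k (i, j); first by rewrite /= !eqxx /= ?andbF.
    have := F'P k; rewrite !inE kF andbT ne => /(_ isT).
    by case: (k.1 == i); case: (k.2 == i); case: (k.1 == j); case: (k.2 == j).
  rewrite satU inE (_ : sat g (avoiding i _) _ = C f); last first.
    apply: eq_sat => k; rewrite !inE !ffunE.
    by move=> /andP[_ /andP[/negbTE -> /negbTE ->]].
  by case: (C f); case: (sat g _ _); rewrite ?mulr1.
have cB f : (C f)%:R * #|B f|%:R = \sum_y (sat g (avoiding i F) (upd f j y))%:R :> R.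
  rewrite -sum1_card natr_sum mulr_sumr big_mkcond; apply: eq_bigr => y _.
  rewrite (_ : avoiding i F = avoiding i (avoiding j F) :|: touching j F')%SET; last first.
    apply/setP => k; rewrite !inE; case kF: (k \in F); rewrite /= ?andbF //.
    have [->|ne] := eqVneq k (i, j); first by rewrite /= !eqxx /= ?andbF.
    have := F'P k; rewrite !inE kF andbT ne => /(_ isT).
    by case: (k.1 == i); case: (k.2 == i); case: (k.1 == j); case: (k.2 == j).
  rewrite satU inE (_ : sat g (avoiding i _) _ = C f); last first.
    apply: eq_sat => k; rewrite !inE !ffunE.
    by move=> /andP[/andP[_ /andP[/negbTE -> /negbTE ->]] _].
  by case: (C f); case: (sat g _ _); rewrite ?mulr1.
have cF : #|V|%:R * (#|V|%:R * (sat_count R g F - p * sat_count R g F')) =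
    \sum_f (C f)%:R * (\sum_(x in A f) \sum_(y in B f) (g (i, j) x y)%:R
       - p * (#|A f|%:R * #|B f|%:R)) :> R.
  pose phi f : R := (sat g F f)%:R - p * (sat g F' f)%:R.
  have -> : sat_count R g F - p * sat_count R g F' = \sum_f phi f.
    by rewrite /sat_count mulr_sumr -sumrB.
  rewrite (sum_upd phi j) (sum_upd (fun f => \sum_x phi (upd f j x)) i) /phi.
  apply: eq_bigr => f _.
  transitivity (\sum_(x in A f) \sum_(y in B f) (C f)%:R * ((g (i, j) x y)%:R - p)).
    rewrite [RHS]big_mkcond; apply: eq_bigr => x _; rewrite -[RHS]/(if _ then _ else _).
    case xA: (x \in A f); last first.
      by apply: big1 => y _; rewrite satF satF' xA !andbF mulr0 subrr.
    rewrite [RHS]big_mkcond; apply: eq_bigr => y _ /=.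
    rewrite satF satF' xA /=; case: (y \in B f); rewrite ?andbF ?andbT ?mulr0 ?subrr //.
    by case: (C f); case: (g _ _ _); rewrite ?mul0r ?mul1r ?mulr1 ?mulr0 ?subrr.
  under eq_bigr do rewrite -mulr_sumr sumrB sumr_const.
  rewrite -mulr_sumr sumrB sumr_const -mulrnA -[p *+ _]mulr_natl natrM.
  by congr (_ * (_ - _)); ring.
rewrite -(ler_pM2l n0); apply: (@le_trans _ _ (\sum_f (C f)%:R * (b * (#|A f| + #|B f|)%:R))).
  rewrite -(ger0_norm (ltW n0)) -normrM -normrM cF.
  apply: le_trans (ler_norm_sum _ _ _) _; apply: ler_sum => f _.
  by rewrite normrM ger0_norm // ler_wpM2l.
rewrite [leRHS]mulrCA mulrDr.
rewrite (sum_upd (fun f => (sat g (avoiding i F) f)%:R) j).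
rewrite (sum_upd (fun f => (sat g (avoiding j F) f)%:R) i).
rewrite -big_split mulr_sumr; apply: ler_sum => f _ /=.
by rewrite -cA -cB natrD mulrCA mulrDr addrC.
Qed.

Lemma card_touching (s : nat) (i : 'I_s) (F : {set 'I_s * 'I_s}) :
  (forall k, k \in F -> (k.1 < k.2)%N) -> (#|touching i F| <= s)%N.
Proof.
move=> Flt; pose other (k : 'I_s * 'I_s) := if k.1 == i then k.2 else k.1.
rewrite -[leqRHS]card_ord -(@card_in_imset _ _ other); first exact: max_card.
move=> [a b] [c d]; rewrite !inE /= => /andP[/Flt /= ab abi] /andP[/Flt /= cd cdi].
rewrite /other /=; move: abi cdi.
have [ai|ai] /= := eqVneq a i; have [ci|ci] /= := eqVneq c i.
- by move=> _ _ ->; rewrite ai ci.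
- by move=> _ /eqP di E; exfalso; subst; lia.
- by move=> /eqP bi _ E; exfalso; subst; lia.
by move=> /eqP -> /eqP -> ->.
Qed.

(** Removing a pair multiplies the density by [P k], up to an error that involves
    the densities of [avoiding i F] and [avoiding j F].  These have fewer
    constraints, so by induction they are at most twice their expected value,
    and at most [s] constraints touch one vertex, so that this expected value
    exceeds the one of [F] by a factor of at most [q ^- s].  Hence each removal
    costs a relative error [eta]. *)
Lemma sat_count_density (R : realType) (s : nat) (V : finType)
    (g : 'I_s * 'I_s -> rel V) (P : 'I_s * 'I_s -> R) (q b : R) :
  (0 < #|V|)%N -> 0 <= b -> 0 < q -> (forall k, q <= P k <= 1) ->
  (forall (k : 'I_s * 'I_s) (A B : {set V}), (k.1 < k.2)%N ->
    `|\sum_(x in A) \sum_(y in B) (g k x y)%:R - P k * (#|A|%:R * #|B|%:R)|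
      <= b * (#|A| + #|B|)%:R) ->
  let eta := 4 * b / (#|V|%:R * q ^+ s) in
  (s * s)%:R * eta <= 1 ->
  forall F : {set 'I_s * 'I_s}, (forall k, k \in F -> (k.1 < k.2)%N) ->
  `|sat_count R g F / #|V|%:R ^+ s - \prod_(k in F) P k|
    <= #|F|%:R * eta * \prod_(k in F) P k.
Proof.
move=> V0 b0 q0 Pq disc eta eta1 F; have n0 : 0 < #|V|%:R :> R by rewrite ltr0n.
have P0 k : 0 < P k by have /andP[/(lt_le_trans q0)] := Pq k.
have q1 : (0 < s)%N -> q <= 1.
  move=> s0; have /andP[h1 h2] := Pq (Ordinal s0, Ordinal s0).
  exact: le_trans h1 h2.
have e0 : 0 <= eta by rewrite divr_ge0 ?mulr_ge0 ?exprn_ge0 // ltW.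
move Em : #|F| => m; elim/ltn_ind: m F Em => m IH F Em Flt.
have [F0|[[i j] ijF]] := set_0Vmem F.
  rewrite F0 big_set0 /sat_count (eq_bigr (fun=> 1)); last first.
    by move=> f _; rewrite /sat; case: forall_inP => // -[] k; rewrite inE.
  rewrite sumr_const card_ffun card_ord natrX divff ?expf_neq0 ?gt_eqF //.
  by rewrite subrr normr0 mulr1 mulr_ge0.
have PF0 (G : {set 'I_s * 'I_s}) : 0 <= \prod_(k in G) P k.
  by apply: prodr_ge0 => k _; apply: ltW.
have small (G : {set 'I_s * 'I_s}) : (#|G| <= s * s)%N.
  by rewrite -[s in (_ <= s * _)%N]card_ord -[s in (_ <= _ * s)%N]card_ord -card_prod max_card.
have avoid_card l : l \in [set i; j]%SET -> (#|avoiding l F| < m)%N.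
  move=> lij; rewrite -Em; apply/proper_card/properP; split.
    by apply/fintype.subsetP => k; rewrite inE => /andP[].
  exists (i, j); rewrite // inE ijF /=.
  by move: lij; rewrite !inE => /orP[]/eqP ->; rewrite eqxx ?andbF.
have avoid_le l : l \in [set i; j]%SET ->
    sat_count R g (avoiding l F) / #|V|%:R ^+ s * q ^+ s <= 2 * \prod_(k in F) P k.
  move=> lij; have aF k : k \in avoiding l F -> (k.1 < k.2)%N.
    by rewrite inE => /andP[/Flt].
  have := IH _ (avoid_card _ lij) _ erefl aF.
  set t := _ / _; set Pa := \prod_(k in avoiding _ _) _ => h.
  have h1 : #|avoiding l F|%:R * eta <= 1.
    by apply: le_trans eta1; rewrite ler_wpM2r // ler_nat.
  have h2 : t <= 2 * Pa.
    have := ler_wpM2r (PF0 (avoiding l F)) h1; rewrite -/Pa.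
    by move: h; rewrite ler_norml; lra.
  apply: (@le_trans _ _ (2 * (Pa * q ^+ s))).
    by rewrite mulrA ler_wpM2r // exprn_ge0 // ltW.
  rewrite ler_wpM2l //.
  have -> : \prod_(k in F) P k = Pa * \prod_(k in touching l F) P k.
    rewrite (bigID (mem (avoiding l F))) /=; congr (_ * _); apply: eq_bigl => k.
      by rewrite !inE andbA andbb.
    by rewrite !inE; case: (k \in F) => //=; rewrite negb_and !negbK.
  rewrite ler_wpM2l ?PF0 //.
  apply: (@le_trans _ _ (\prod_(k in touching l F) q)).
    rewrite prodr_const; apply: ler_wiXn2l; first exact: ltW.
      by apply: q1; apply: leq_ltn_trans (ltn_ord l).
    exact: card_touching.
  by apply: ler_prod => k _; have /andP[-> _] := Pq k; rewrite ltW.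
set PF := \prod_(k in F) P k.
have PFE : PF = P (i, j) * \prod_(k in (F :\ (i, j))%SET) P k by rewrite /PF (big_setD1 _ ijF).
have := @sat_remove_pair R s V g F i j (P (i, j)) b V0 Flt ijF _.
have lij : (i < j)%N := Flt _ ijF.
move=> /(_ (fun A B => disc (i, j) A B lij)) rem.
set N := #|V|%:R ^+ s; have N0 : 0 < N by rewrite exprn_gt0.
set t := sat_count R g F / N; set t' := sat_count R g (F :\ (i, j))%SET / N.
have step : `|t - P (i, j) * t'| <= eta * PF.
  have qs0 : 0 < q ^+ s by rewrite exprn_gt0.
  have -> : t - P (i, j) * t' =
      (sat_count R g F - P (i, j) * sat_count R g (F :\ (i, j))%SET) / N.
    by rewrite /t /t'; ring.
  rewrite normrM [`|N^-1|]ger0_norm ?invr_ge0 ?(ltW N0) //.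
  rewrite /eta [leRHS]mulrAC ler_pdivlMr ?mulr_gt0 //.
  have ai := avoid_le i; rewrite !inE eqxx in ai; have {}ai := ai isT.
  have aj := avoid_le j; rewrite !inE eqxx orbT in aj; have {}aj := aj isT.
  have := ler_wpM2l b0 (lerD ai aj); rewrite -/N -/PF -!mulrA -!mulrDl => aij.
  set X := `|_ |; apply: (@le_trans _ _ ((#|V|%:R * X) * (N^-1 * q ^+ s))).
    by rewrite le_eqVlt; apply/orP; left; apply/eqP; ring.
  apply: le_trans (ler_wpM2r _ rem) _; first by rewrite mulr_ge0 ?invr_ge0 // ltW.
  rewrite -mulrA; apply: le_trans aij _.
  by rewrite le_eqVlt; apply/orP; left; apply/eqP; ring.
have F'c : (#|(F :\ (i, j))%SET|).+1 = m by rewrite -Em (cardsD1 (i, j) F) ijF.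
have F'm : (#|(F :\ (i, j))%SET| < m)%N by rewrite -F'c.
have F'lt k : k \in (F :\ (i, j))%SET -> (k.1 < k.2)%N by rewrite inE => /andP[_ /Flt].
have := IH _ F'm _ erefl F'lt; rewrite -/N -/t' => h.
have h' := ler_wpM2l (ltW (P0 (i, j))) h.
have -> : t - PF = (t - P (i, j) * t') + P (i, j) * (t' - \prod_(k in (F :\ (i, j))%SET) P k).
  by rewrite PFE; ring.
apply: le_trans (ler_normD _ _) _; rewrite [X in _ + X <= _]normrM (ger0_norm (ltW (P0 _))).
apply: le_trans (lerD step h') _; rewrite -F'c -natr1 PFE.
by rewrite le_eqVlt; apply/orP; left; apply/eqP; ring.
Qed.

(** * Labelled embeddings and induced copies *)

Definition embeddings (V W : finType) (G : sgraph V) (H : sgraph W) : {set {ffun W -> V}} :=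
  [set f : {ffun W -> V} | injectiveb f &&
     [forall x, forall y, adj G (f x) (f y) == adj H x y]]%SET.

Lemma embeddingsP (V W : finType) (G : sgraph V) (H : sgraph W) (f : {ffun W -> V}) :
  reflect (injective f /\ forall x y, adj G (f x) (f y) = adj H x y)
    (f \in embeddings G H).
Proof.
rewrite inE; apply: (iffP andP) => [[/injectiveP inj /forallP h]|[inj h]]; split=> //.
- by move=> x y; apply/eqP/(forallP (h x)).
- exact/injectiveP.
by apply/forallP => x; apply/forallP => y; rewrite h.
Qed.

Lemma adj_induced (V : finType) (G : sgraph V) (S : {set V}) (x y : {x : V | x \in S}) :
  adj (Defs.induced G S) x y = adj G (val x) (val y).
Proof. by rewrite /adj inE imsetU1 imset_set1. Qed.

Lemma isomorphicP (V W : finType) (G : sgraph V) (H : sgraph W) :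
  reflect (exists (f : V -> W) (h : W -> V), [/\ cancel f h, cancel h f &
             forall x y, adj H (f x) (f y) = adj G x y])
    (isomorphic G H).
Proof.
apply: (iffP existsP) => [[f /and3P[/injectiveP inj /forallP sur /forallP hom]]|].
  exists f; have [h fh hf] : bijective f.
    apply: inj_card_bij => //; rewrite -(card_codom inj); apply: subset_leq_card.
    by apply/fintype.subsetP => w _; apply: sur.
  by exists h; split=> // x y; apply/eqP/(forallP (hom x)).
move=> [f [h [fh hf hom]]]; exists [ffun x => f x]; apply/and3P; split.
- by apply/injectiveP => x y; rewrite !ffunE => /(can_inj fh).
- by apply/forallP => w; apply/codomP; exists (h w); rewrite ffunE hf.
by apply/forallP => x; apply/forallP => y; rewrite !ffunE hom.
Qed.

(** Precomposing one embedding with image [S] with the automorphisms of [H] gives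
    each embedding with image [S] exactly once. *)
Lemma card_embeddings_onto (V W : finType) (G : sgraph V) (H : sgraph W) (S : {set V}) :
  #|[set f in embeddings G H | f @: [set: W] == S]%SET| =
  (#|Aut_graph H| * isomorphic (Defs.induced G S) H)%N.
Proof.
case: isomorphicP => [[phi [psi [fK hK hom]]]|noniso]; last first.
  rewrite muln0; apply/eqP; rewrite cards_eq0; apply/eqP/setP => f.
  rewrite [RHS]inE; apply/negbTE/negP; rewrite inE.
  case/andP=> fe /eqP fS; apply: noniso; move/embeddingsP: fe => [inj fh].
  have mS w : f w \in S by rewrite -fS imset_f.
  pose h w : {x : V | x \in S} := exist _ (f w) (mS w).
  have hinj : injective h by move=> x y /(congr1 val) /= /inj.
  have [phi hK phK] : bijective h.
    by apply: inj_card_bij hinj _; rewrite card_sig -fS card_imset // cardsT.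
  exists phi, h; split=> // x y.
  by rewrite -[x in RHS]phK -[y in RHS]phK adj_induced /= fh.
rewrite muln1.
have injval : injective (fun w => val (psi w)).
  by move=> x y /val_inj /(can_inj hK).
pose ext (u : {perm W}) : {ffun W -> V} := [ffun w => val (psi (u w))].
have extinj : injective ext.
  move=> u v /ffunP uv; apply/permP => w.
  by have := uv w; rewrite !ffunE => /injval.
rewrite -(card_imset _ extinj); apply: eq_card => f; apply/idP/imsetP.
  rewrite inE => /andP[/embeddingsP[inj fh] /eqP fS].
  have mS w : f w \in S by rewrite -fS imset_f.
  pose h w := phi (exist _ (f w) (mS w)).
  have hinj : injective h by move=> x y /(can_inj fK) /(congr1 val) /= /inj.
  exists (perm hinj).
    rewrite inE; apply/forallP => x; apply/forallP => y.
    by rewrite !permE hom adj_induced /= fh.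
  by apply/ffunP => w; rewrite ffunE permE /h fK.
move=> [u]; rewrite [u \in _]inE => /forallP uaut ->.
rewrite inE; apply/andP; split.
  apply/embeddingsP; split=> [x y|x y]; first by rewrite !ffunE => /injval /perm_inj.
  rewrite !ffunE -adj_induced -hom !hK.
  by have /forallP/(_ y)/eqP := uaut x.
apply/eqP/setP => x; apply/imsetP/idP => [[w _ ->]|xS]; first by rewrite ffunE (valP (psi _)).
exists ((u^-1)%g (phi (exist _ x xS))) => //.
by rewrite ffunE permKV fK.
Qed.

Lemma card_embeddings (V W : finType) (G : sgraph V) (H : sgraph W) :
  #|embeddings G H| = (#|Aut_graph H| * induced_copies G H)%N.
Proof.
rewrite -sum1_card (partition_big (fun f : {ffun W -> V} => f @: [set: W])%SET predT) //=.
rewrite /induced_copies -sum1_card big_distrr /= [RHS]big_mkcond; apply: eq_bigr => S _.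
rewrite sum1_card inE muln1.
rewrite (_ : (if _ then _ else _) = #|Aut_graph H| * isomorphic (Defs.induced G S) H)%N; last first.
  by case: isomorphic; rewrite ?muln1 ?muln0.
by rewrite -card_embeddings_onto; apply: eq_card => f; rewrite [RHS]inE.
Qed.

Definition upper (s : nat) : {set 'I_s * 'I_s} :=
  [set k : 'I_s * 'I_s | (k.1 < k.2)%N]%SET.

(** Non-adjacent pairs must also be sent to distinct vertices: then the maps that
    satisfy all constraints are automatically injective. *)
Definition adj_constraint (V : finType) (s : nat) (G : sgraph V) (H : sgraph 'I_s)
    (k : 'I_s * 'I_s) : rel V :=
  fun x y => if adj H k.1 k.2 then adj G x y else (x != y) && ~~ adj G x y.

Definition adj_density (R : realType) (p : R) (s : nat) (H : sgraph 'I_s) (k : 'I_s * 'I_s) : R :=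
  if adj H k.1 k.2 then p else 1 - p.

Lemma sat_upperE (V : finType) (s : nat) (G : sgraph V) (H : sgraph 'I_s) f :
  sat (adj_constraint G H) (upper s) f = (f \in embeddings G H).
Proof.
apply/forall_inP/embeddingsP => [h|[inj h] [i j]]; last first.
  rewrite inE /= => ij; rewrite /adj_constraint /= h.
  case: (adj H i j) => //=; rewrite andbT (inj_eq inj).
  by apply: contraTneq ij => ->; rewrite ltnn.
have lt (i j : 'I_s) : (i < j)%N -> f i != f j /\ adj G (f i) (f j) = adj H i j.
  move=> ij; have := h (i, j); rewrite inE /= => /(_ ij); rewrite /adj_constraint /=.
  case: ifP => _; last by case/andP=> -> /negbTE.
  by move=> a; split=> //; apply: contraTneq a => ->; rewrite adjxx.
split=> [i j E|i j].
  apply/val_inj/eqP; case: ltngtP => // /lt [/eqP]; by rewrite E.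
case: (ltngtP i j) => [/lt[]//|/lt[_]|/val_inj ->]; last by rewrite !adjxx.
by rewrite adjC => ->; rewrite adjC.
Qed.

Lemma card_upper (s : nat) (H : sgraph 'I_s) :
  #|[set k in upper s | adj H k.1 k.2]%SET| = #|edges H| /\ #|upper s| = 'C(s, 2).
Proof.
pose pr (k : 'I_s * 'I_s) := [set k.1; k.2]%SET.
have prinj : {in upper s &, injective pr}.
  move=> [a b] [c d]; rewrite !inE /= => ab cd /eqP; rewrite eq_pair /=.
  case/orP => /andP[/eqP ? /eqP ?]; subst => //; exfalso; lia.
have sub : {subset [set k in upper s | adj H k.1 k.2]%SET <= upper s}.
  by move=> k; rewrite inE => /andP[].
have im (e : {set 'I_s}) : e \in pairs 'I_s -> exists2 k, k \in upper s & e = pr k.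
  rewrite inE => /cards2P[a [b [ab ->]]].
  have [lt|gt|E] := ltngtP a b.
  - by exists (a, b) => //; rewrite inE.
  - by exists (b, a); rewrite ?inE // /pr /= finset.setUC.
  - by rewrite (val_inj E) eqxx in ab.
split.
  rewrite -(card_in_imset (f := pr)); last first.
    by move=> k l /sub ku /sub lu; apply: prinj.
  apply: eq_card => e; apply/imsetP/idP => [[k]|eH].
    by rewrite inE => /andP[_ kH] ->.
  have [k ku E] := im e (fintype.subsetP (edgesP H) _ eH).
  by exists k => //; rewrite inE ku /adj -/(pr k) -E.
rewrite -(card_in_imset prinj) -[s in RHS]card_ord -card_draws.
apply: eq_card => e; apply/imsetP/idP => [[k ku ->]|/im//].
rewrite -/(pairs _) pairsE; move: ku; rewrite inE => ku.
by apply: contraTneq ku => ->; rewrite ltnn.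
Qed.

Lemma prod_adj_density (R : realType) (p : R) (s : nat) (H : sgraph 'I_s) : p != 1 ->
  \prod_(k in upper s) adj_density p H k =
  (p / (1 - p)) ^+ #|edges H| * (1 - p) ^+ 'C(s, 2).
Proof.
move=> p1; have q0 : 1 - p != 0 by rewrite subr_eq0 eq_sym.
have [<- <-] := card_upper H.
rewrite -2!prodr_const /= (_ : \prod_(k in [set k in upper s | _]%SET) _ =
  \prod_(k in upper s) (if adj H k.1 k.2 then p / (1 - p) else 1)); last first.
  by rewrite -big_mkcondr; apply: eq_bigl => k; rewrite inE.
rewrite -big_split /=; apply: eq_bigr => k _.
by rewrite /adj_density; case: ifP => _; rewrite ?mul1r // divfK.
Qed.

(** For prescribed non-adjacency, the pairs [(x, x)] that have to be left out
    cost at most [|A|], whence [b + 1] in place of [b]. *)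
Lemma jumbled_constraint (R : realType) (V : finType) (s : nat) (G : sgraph V)
    (H : sgraph 'I_s) (p b : R) (k : 'I_s * 'I_s) (A B : {set V}) :
  jumbled p b G ->
  `|\sum_(x in A) \sum_(y in B) (adj_constraint G H k x y)%:R
     - adj_density p H k * (#|A|%:R * #|B|%:R)| <= (b + 1) * (#|A| + #|B|)%:R.
Proof.
move=> /forallP/(_ A)/forallP/(_ B).
set e := (crossing _ _ _)%:R; set sg := (_ + _)%:R => h.
have sg0 : 0 <= sg by [].
have eE : e = \sum_(x in A) \sum_(y in B) (adj G x y)%:R.
  by rewrite /e /crossing natr_sum; apply: eq_bigr => x _; rewrite natr_sum.
rewrite /adj_constraint /adj_density; case: ifP => _.
  by rewrite -eE; apply: le_trans h _; rewrite [leRHS]mulrDl mul1r lerDl.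
have dE : \sum_(x in A) \sum_(y in B) (x == y)%:R = #|A :&: B|%:R :> R.
  rewrite -sum1_card natr_sum [LHS]big_mkcond [RHS]big_mkcond; apply: eq_bigr => x _.
  rewrite inE; case: (x \in A) => //=; case xB: (x \in B).
    by rewrite (bigD1 x) //= eqxx big1 ?addr0 // => y /andP[_ /negbTE]; rewrite eq_sym => ->.
  by apply: big1 => y yB; case: eqP => // E; rewrite E yB in xB.
have -> : \sum_(x in A) \sum_(y in B) ((x != y) && ~~ adj G x y)%:R =
    #|A|%:R * #|B|%:R - #|A :&: B|%:R - e :> R.
  rewrite -dE eE -natrM -sum_nat_const natr_sum -!sumrB; apply: eq_bigr => x _.
  rewrite -[#|B|]muln1 -sum_nat_const natr_sum -!sumrB; apply: eq_bigr => y _.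
  case: eqP => [->|_]; first by rewrite adjxx /= subrr subr0.
  by case: (adj G x y); rewrite /= subr0 ?subrr ?subr0.
have c1 : #|A :&: B|%:R <= sg.
  by rewrite ler_nat (leq_trans _ (leq_addr _ _)) // subset_leq_card // finset.subsetIl.
have c0 : 0 <= #|A :&: B|%:R :> R by [].
move: h; set ab : R := #|A|%:R * #|B|%:R => h; rewrite [leRHS]mulrDl mul1r.
rewrite (_ : _ - _ = - ((e - p * ab) + #|A :&: B|%:R)); last by ring.
rewrite normrN; apply: le_trans (ler_normD _ _) _.
by rewrite lerD // ger0_norm.
Qed.

(** * The deviation of all counts *)

Lemma ffact_bounds (R : realType) (n s : nat) : (s <= n)%N -> (0 < n)%N ->
  1 - (s * s)%:R / n%:R <= ((n ^_ s)%:R / n%:R ^+ s : R) <= 1.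
Proof.
move=> + n0; have n0' : 0 < n%:R :> R by rewrite ltr0n.
elim: s => [|s IH] sn.
  by rewrite ffactn0 expr0 mul0r subr0 divr1 lexx.
have /andP[IH1 IH2] := IH (ltnW sn).
set r : R := (n ^_ s)%:R / n%:R ^+ s in IH1 IH2 *.
have r0 : 0 <= r by rewrite divr_ge0 // exprn_ge0.
set x : R := s%:R / n%:R.
have -> : (n ^_ s.+1)%:R / n%:R ^+ s.+1 = r * (1 - x) :> R.
  rewrite ffactnSr natrM natrB ?(ltnW sn) // exprS /r /x; field.
  by rewrite !gt_eqF ?exprn_gt0.
have x0 : 0 <= x by rewrite divr_ge0.
have x1 : x <= 1 by rewrite ler_pdivrMr // mul1r ler_nat ltnW.
have E : (s.+1 * s.+1)%:R / n%:R = (s * s)%:R / n%:R + 2 * x + n%:R^-1 :> R.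
  by rewrite /x !natrM -natr1; field; rewrite gt_eqF.
have ni : 0 < n%:R^-1 :> R by rewrite invr_gt0.
have rx : r * x <= x by rewrite ler_piMl.
have rx0 : 0 <= r * x by rewrite mulr_ge0.
by rewrite E mulrBr mulr1; apply/andP; split; lra.
Qed.

Lemma copies_deviation_le (R : realType) (n s : nat) (p q b : R) (G : sgraph 'I_n)
    (H : sgraph 'I_s) :
  (0 < n)%N -> 0 <= b -> 0 < q -> q <= p -> q <= 1 - p ->
  jumbled p b G ->
  let delta := (s * s)%:R * (4 * (b + 1) / (n%:R * q ^+ s)) in
  delta <= 1 -> (s * s)%:R / n%:R <= 1 / 2 :> R ->
  copies_deviation p G H <= 2 * (delta + (s * s)%:R / n%:R).
Proof.
move=> n0 b0 q0 qp qp1 Gj delta d1 sn2.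
have n0' : 0 < n%:R :> R by rewrite ltr0n.
have sn : (s <= n)%N.
  have := sn2; rewrite ler_pdivrMr // => h.
  have : (s * s)%:R <= n%:R :> R by lra.
  by rewrite ler_nat; case: s {H delta d1 sn2 h} => // s; apply: leq_trans; rewrite leq_pmulr.
set PF := \prod_(k in upper s) adj_density p H k.
have dens k : q <= adj_density p H k <= 1.
  by rewrite /adj_density; case: ifP => _; apply/andP; split; lra.
have PF0 : 0 < PF.
  by apply: prodr_gt0 => k _; have /andP[h _] := dens k; apply: lt_le_trans h.
have := @sat_count_density R s 'I_n (adj_constraint G H) (adj_density p H) q (b + 1).
rewrite card_ord => /(_ n0).
have b1 : 0 <= b + 1 by lra.
move=> /(_ b1 q0 dens (fun k A B _ => jumbled_constraint H k A B Gj) d1).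
have up k : k \in upper s -> (k.1 < k.2)%N by rewrite inE.
move=> /(_ (upper s) up); rewrite -/PF.
have -> : sat_count R (adj_constraint G H) (upper s) =
    (#|Aut_graph H| * induced_copies G H)%:R.
  rewrite -card_embeddings -sum1_card natr_sum [RHS]big_mkcond /=.
  by apply: eq_bigr => f _; rewrite sat_upperE; case: (f \in _).
set c : R := (_ * _)%:R => h.
have /andP[rho0 rho1] := ffact_bounds R sn n0.
set rho := (n ^_ s)%:R / n%:R ^+ s in rho0 rho1.
have A0 : 0 < #|Aut_graph H|%:R :> R.
  rewrite ltr0n; apply/card_gt0P; exists 1%g; rewrite inE.
  by apply/forallP => x; apply/forallP => y; rewrite !perm1.
have ns0 : 0 < n%:R ^+ s :> R by rewrite exprn_gt0.
have rho2 : 1 / 2 <= rho by lra.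
have F0 : (n ^_ s)%:R != 0 :> R.
  by apply/eqP => E; move: rho2; rewrite /rho E mul0r; lra.
have p1 : p != 1 by apply/eqP => E; move: qp1; rewrite E subrr; lra.
have exp_eq : (induced_copies G H)%:R / expected_copies n p H = (c / n%:R ^+ s / PF) / rho.
  rewrite /expected_copies -mulrA -prod_adj_density // -/PF /c /rho natrM.
  by field; rewrite F0 !gt_eqF.
rewrite /copies_deviation exp_eq.
set r := c / _ / PF.
have r1 : `|r - 1| <= delta.
  have -> : r - 1 = (c / n%:R ^+ s - PF) / PF by rewrite /r mulrBl divff ?gt_eqF.
  rewrite normrM [`|PF^-1|]ger0_norm ?invr_ge0 ?(ltW PF0) // ler_pdivrMr //.
  apply: le_trans h _; rewrite ler_wpM2r ?(ltW PF0) // /delta ler_wpM2r //.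
    by rewrite divr_ge0 ?mulr_ge0 ?exprn_ge0 // ltW.
  rewrite ler_nat -[s in (_ <= s * _)%N]card_ord -[s in (_ <= _ * s)%N]card_ord.
  by rewrite -card_prod max_card.
have -> : r / rho - 1 = (r - rho) / rho by rewrite mulrBl divff // gt_eqF //; lra.
rewrite normrM [`|rho^-1|]ger0_norm; last by rewrite invr_ge0; lra.
rewrite ler_pdivrMr; last by lra.
set e := (s * s)%:R / n%:R in sn2 rho0 *.
have e0 : 0 <= e by rewrite divr_ge0.
have d0 : 0 <= delta by apply: le_trans r1.
have : `|r - rho| <= delta + e.
  move: r1; rewrite !ler_norml => /andP[? ?]; apply/andP; split; lra.
move/le_trans; apply.
have : (delta + e) * (1 / 2) <= (delta + e) * rho by rewrite ler_wpM2l //; lra.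
by lra.
Qed.

(** With the convention [0^-1 = 0], the range of [s] is empty for [p = 0] and
    for [p = 1]. *)
Lemma gamma_trivial (R : realType) (p : R) : 0 <= p <= 1 -> ~~ (0 < p < 1) ->
  ln (gamma p) = 0.
Proof.
move=> /andP[p0 p1]; rewrite negb_and -!leNgt => /orP[h|h].
  have -> : p = 0 by lra.
  by rewrite /gamma subr0 invr0 invr1 max_r ?ln1.
have -> : p = 1 by lra.
by rewrite /gamma subrr invr0 invr1 max_l ?ln1.
Qed.

Lemma ln2_ge (R : realType) : 1 / 2 <= ln 2 :> R.
Proof.
have := @le_ln1Dx R (- (1 / 2)); rewrite (_ : 1 + - (1 / 2) = 2^-1); last by field.
rewrite lnV ?posrE //; lra.
Qed.

(** Exponentiating the bound on [s] gives
    [gamma ^ s <= sqrt n * gamma ^ (- 10 ln L)] for [L = ln n], and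
    [gamma >= 2] with [ln 2 >= 1 / 2] turns the last factor into [L ^- 5]. *)
Lemma size_bound_facts (R : realType) (n s : nat) (p : R) :
  (0 < n)%N -> 1 <= ln n%:R :> R -> 0 <= p <= 1 -> (0 < s)%N ->
  s%:R <= size_bound 10 n p ->
  [/\ 0 < p < 1, 2 <= gamma p, s%:R <= ln n%:R :> R &
      gamma p ^+ s <= Num.sqrt n%:R / ln n%:R ^+ 5].
Proof.
move=> n0 L1 p01 s0; rewrite /size_bound; set L := ln n%:R in L1 *.
have n0' : 0 < n%:R :> R by rewrite ltr0n.
have l0 : 0 <= ln L by rewrite ln_ge0.
have s1 : 1 <= s%:R :> R by rewrite ler1n.
have [/[dup] p01' /andP[p0 p1]|triv] := boolP (0 < p < 1); last first.
  by rewrite gamma_trivial // invr0 mulr0 mulr0; lra.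
have g2 : 2 <= gamma p.
  rewrite /gamma le_max; have [h|h] := leP p (1 / 2); apply/orP; [left|right].
    by rewrite -[2]invrK lef_pV2 ?posrE //; lra.
  by rewrite -[2]invrK lef_pV2 ?posrE ?subr_gt0 //; lra.
have lg : 1 / 2 <= ln (gamma p).
  by apply: le_trans (ln2_ge R) _; rewrite ler_ln ?posrE //; lra.
set lam := ln (gamma p) in lg *.
have lam0 : 0 < lam by lra.
move=> sb; have sb1 : s%:R * lam <= L / 2 - 10 * ln L * lam.
  move: sb; rewrite -(ler_pM2r lam0) => /le_trans; apply.
  rewrite le_eqVlt; apply/orP; left; apply/eqP; field; lra.
have ll : ln L / 2 <= ln L * lam by rewrite ler_wpM2l //; lra.
split=> //.
  have : s%:R / 2 <= s%:R * lam by rewrite ler_wpM2l //; lra.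
  by move: ll l0 sb1; lra.
have -> : gamma p ^+ s = expR (s%:R * lam).
  by rewrite expRM_natl lnK // posrE; lra.
apply: (@le_trans _ _ (expR (L / 2 - 5%:R * ln L))).
  by rewrite ler_expR; lra.
rewrite expRD expRN expRM_natl lnK ?posrE; last by lra.
have -> // : expR (L / 2) = Num.sqrt n%:R.
rewrite -[LHS]ger0_norm ?expR_ge0 // -sqrtr_sqr -expRM_natl; congr Num.sqrt.
by rewrite mulrC divfK // lnK.
Qed.

(** Here [eta] is of order [sqrt n * L * gamma ^ s / n], hence at most [24 / L ^ 4],
    while [s <= L]; and [s <= gamma ^ s] controls the gap between [n ^_ s] and
    [n ^ s]. *)
Lemma jumbled_copies_deviation (R : realType) (n s : nat) (p : R) (G : sgraph 'I_n)
    (H : sgraph 'I_s) :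
  (0 < n)%N -> 5 <= ln n%:R :> R -> 0 <= p <= 1 -> (0 < s)%N ->
  s%:R <= size_bound 10 n p ->
  jumbled p (5 * (Num.sqrt n%:R * ln n%:R)) G ->
  copies_deviation p G H <= 50 / ln n%:R.
Proof.
move=> n0 L5 p01 s0 sb Gj; set L := ln n%:R in L5 Gj *.
have L1 : 1 <= L by lra.
have [/andP[p0 p1] g2 sL gs] := size_bound_facts n0 L1 p01 s0 sb.
rewrite -/L in sL gs; set w := Num.sqrt n%:R in Gj gs.
have n0' : 0 < n%:R :> R by rewrite ltr0n.
have w2 : w ^+ 2 = n%:R by rewrite sqr_sqrtr // ltW.
have w1 : 1 <= w by rewrite -[leLHS]sqrtr1 ler_wsqrtr // ler1n.
have L0 : 0 < L by lra.
have g0 : 0 < gamma p by lra.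
pose q := (gamma p)^-1.
have q0 : 0 < q by rewrite invr_gt0.
have qp : q <= p.
  by rewrite /q invf_ple ?posrE // /gamma le_max lexx.
have qp1 : q <= 1 - p.
  by rewrite /q invf_ple ?posrE ?subr_gt0 // /gamma le_max lexx orbT.
have wL1 : 1 <= w * L by rewrite -[1]mulr1 ler_pM.
have ss : (s * s)%:R <= L ^+ 2 by rewrite natrM expr2 ler_pM.
have eta : 4 * (5 * (w * L) + 1) / (n%:R * q ^+ s) <= 24 / L ^+ 4.
  rewrite exprVn invfM invrK.
  apply: (@le_trans _ _ (4 * (6 * (w * L)) * (n%:R^-1 * (w / L ^+ 5)))).
    rewrite ler_pM ?mulr_ge0 ?invr_ge0 ?exprn_ge0 //; try lra.
    by rewrite ler_wpM2l // invr_ge0 ltW.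
  rewrite -w2 le_eqVlt; apply/orP; left; apply/eqP; field.
  by rewrite !gt_eqF //; lra.
have dl : (s * s)%:R * (4 * (5 * (w * L) + 1) / (n%:R * q ^+ s)) <= 24 / L ^+ 2.
  apply: le_trans (ler_pM _ _ ss eta) _ => //.
    by rewrite divr_ge0 ?mulr_ge0 ?exprn_ge0 //; lra.
  by rewrite le_eqVlt; apply/orP; left; apply/eqP; field; rewrite gt_eqF.
have sn : (s * s)%:R / n%:R <= 1 / L ^+ 2.
  have sg : s%:R <= w / L.
    apply: (@le_trans _ _ (gamma p ^+ s)).
      apply: le_trans (lerXn2r s _ _ g2); rewrite ?nnegrE // ?(ltW g0) //.
      rewrite (_ : 2 ^+ s = (2 ^ s)%:R :> R); last by rewrite natrX.
      by rewrite ler_nat ltnW // ltn_expl.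
    apply: le_trans gs _; rewrite ler_wpM2l //; first lra.
    by rewrite lef_pV2 ?posrE ?exprn_gt0 // ler_eXnr.
  rewrite ler_pdivrMr // natrM.
  apply: le_trans (ler_pM _ _ sg sg) _ => //.
  by rewrite -w2 le_eqVlt; apply/orP; left; apply/eqP; field; rewrite gt_eqF.
have L2 : 25 <= L ^+ 2.
  by rewrite (_ : 25 = 5 * 5 :> R) ?expr2 ?ler_pM //; ring.
have iL : 0 < (L ^+ 2)^-1 by rewrite invr_gt0 exprn_gt0.
have iL2 : (L ^+ 2)^-1 * 25 <= 1.
  by rewrite mulrC ler_pdivrMr ?mul1r // exprn_gt0.
have iL3 : (L ^+ 2)^-1 <= L^-1.
  by rewrite lef_pV2 ?posrE ?exprn_gt0 // ler_eXnr.
have b0 : 0 <= 5 * (w * L) by lra.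
apply: le_trans (copies_deviation_le H n0 b0 q0 qp qp1 Gj _ _) _; lra.
Qed.

Theorem theorem2p10 (R : realType) (d : nat -> nat)
    (d_exists : \forall n \near \oo, regular_graphs n (d n) != finset.set0)
    (d_Theta : (fun n => (d n)%:R : R) \is 'Theta_\oo (fun n => n%:R : R)) :
  exists C3 : R, 0 < C3 /\
    forall eps : R, 0 < eps ->
      (fun n =>
         let p : R := (d n)%:R / n%:R in
         unif_pr R (regular_graphs n (d n))
           [pred G | eps < `|max_deviation p (size_bound C3 n p) G|])
        @ \oo --> (0 : R).
Proof.
exists 10; split=> // eps eps0; apply/cvgr0Pnorm_lt => e e0.
near=> n => /=.
have n3 : (3 < n)%N by near: n; apply: nbhs_infty_gt.
have n0 : 0 < n%:R :> R by rewrite ltr0n; lia.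
have Ln (M : R) : expR M <= n%:R -> M <= ln n%:R.
  by move=> h; rewrite -[M]expRK ler_ln ?posrE // expR_gt0.
have L5 : 5 <= ln n%:R :> R by apply: Ln; near: n; apply: nbhs_infty_ger.
have Le : 50 / eps <= ln n%:R :> R by apply: Ln; near: n; apply: nbhs_infty_ger.
have ne : e^-1 < n%:R by near: n; apply: nbhs_infty_gtr.
have reg : regular_graphs n (d n) != finset.set0 by near: n.
have dn : (d n < n)%N.
  have x0 : 'I_n by exists 0%N; lia.
  case/set0Pn: reg => G; rewrite inE => /forallP/(_ x0)/eqP <-; exact: degree_lt.
set p : R := (d n)%:R / n%:R.
have p01 : 0 <= p <= 1.
  by rewrite divr_ge0 //= ler_pdivrMr // mul1r ler_nat ltnW.
have L1 : 1 <= ln n%:R :> R by lra.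
have small := unif_pr_not_jumbled n3 L1 reg.
rewrite ger0_norm; last by rewrite divr_ge0.
apply: le_lt_trans (_ : n%:R^-1 < e); last first.
  by rewrite -[e]invrK ltf_pV2 ?posrE ?invr_gt0.
apply: le_trans small; rewrite /unif_pr ler_wpM2r ?invr_ge0 // ler_nat.
apply/subset_leq_card/fintype.subsetP => G; rewrite !inE => /andP[-> /=].
apply: contraTN => Gj; rewrite -leNgt -/p in Gj *.
rewrite ger0_norm; last by rewrite /max_deviation bigmax_ge_id.
rewrite /max_deviation big_nat; apply: bigmax_le; first exact: ltW.
move=> s /andP[s0 sb]; apply: bigmax_le; first exact: ltW.
move=> H _; apply: (@le_trans _ _ (50 / ln n%:R)).
  have n1 : (0 < n)%N by rewrite -(ltr0n R).
  have sb' : s%:R <= size_bound 10 n p.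
    by case: s s0 sb {H} => // s _; rewrite ltnS truncn_gt_nat.
  exact: (jumbled_copies_deviation H n1 L5 p01 s0 sb' Gj).
rewrite ler_pdivrMr; last by lra.
by move: Le; rewrite ler_pdivrMr // mulrC.
Unshelve. all: by end_near.
Qed.
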